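(* Let $\mathbf{k}$ be an algebraically closed field of characteristic zero, $X=\mathbb{A}^n$, $\mathcal{A}=\mathbf{k}[x_1,\ldots,x_n]$, and $\mathcal{V}=\bigoplus_{i=1}^n\mathcal{A}\frac{\partial}{\partial x_i}$. Every $\mathcal{A}\mathcal{V}$ module $M$ of finite type is a gauge module; that is, there exist a finite-dimensional $\mathbf{k}$-vector space $U$ with $M\cong\mathcal{A}\otimes_{\mathbf{k}}U$ as $\mathcal{A}$-modules, an $\mathcal{A}$-linear representation $\rho$ of $\mathcal{L}_+$ on $\mathcal{A}\otimes U$, and gauge fields $B_1,\ldots,B_n$, such that under this identification the action of $\mathcal{V}$ is given by $$\left(f\frac{\partial}{\partial x_i}\right)(gu)=f\frac{\partial g}{\partial x_i}u+fg\,B_i(u)+\sum_{k\in\mathbb{Z}^n_{\geq0}\setminus\{0\}}\frac{1}{k!}\,g\,\frac{\partial^k f}{\partial x^k}\,\rho\left(x^k\frac{\partial}{\partial x_i}\right)u,\qquad f,g\in\mathcal{A},\ u\in U.$$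
   Context: An $\mathcal{A}\mathcal{V}$ module is an $\mathcal{A}$-module $M$ with a Lie algebra action of $\mathcal{V}$ satisfying $\eta(fm)=f(\eta m)+\eta(f)m$ for $\eta\in\mathcal{V}$, $f\in\mathcal{A}$, $m\in M$; it is of finite type if finitely generated over $\mathcal{A}$. $\mathcal{L}_+\subset\mathcal{V}$ is the subalgebra of vector fields vanishing at the origin (spanned by $x^k\frac{\partial}{\partial x_i}$, $k\ne0$). Multi-index notation: $x^k=x_1^{k_1}\cdots x_n^{k_n}$, $k!=k_1!\cdots k_n!$, $\frac{\partial^k}{\partial x^k}=(\partial/\partial x_1)^{k_1}\cdots(\partial/\partial x_n)^{k_n}$. An $\mathcal{A}$-linear representation of $\mathcal{L}_+$ on $\mathcal{A}\otimes U$ is a Lie algebra homomorphism $\rho:\mathcal{L}_+\to\mathrm{End}_{\mathcal{A}}(\mathcal{A}\otimes U)$; only finitely many $\rho(x^k\frac{\partial}{\partial x_i})$ are nonzero, so the sum is finite. Gauge fields are $\mathcal{A}$-linear maps $B_i:\mathcal{A}\otimes U\to\mathcal{A}\otimes U$, $i=1,\ldots,n$, such that, writing $\frac{\partial}{\partial x_i}$ for $\frac{\partial}{\partial x_i}\otimes\mathrm{id}_U$, (GF1) $\left[\frac{\partial}{\partial x_i}+B_i,\frac{\partial}{\partial x_j}+B_j\right]=0$ for all $i,j$, and (GF2) $\left[\frac{\partial}{\partial x_i}+B_i,\rho(y)\right]=0$ for all $i$ and all $y\in\mathcal{L}_+$. A gauge module is $\mathcal{A}\otimes U$ ($U$ finite-dimensional)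 with such $\rho$ and $B_i$ and with $\mathcal{V}$ acting by the displayed formula. *)

(* Defs.v *)
From HB Require Import structures.
From mathcomp Require Import all_boot all_order all_algebra.
From mathcomp Require Import mpoly.
Set Implicit Arguments. Unset Strict Implicit. Unset Printing Implicit Defensive.
Import GRing.Theory.
Local Open Scope ring_scope.

(* A = k[x_1..x_n] is {mpoly k[n]}.  A vector field sum_i eta_i d/dx_i in V
   is represented by its coefficient row vector eta : 'rV[{mpoly k[n]}]_n. *)
Section VF.
Variables (k : fieldType) (n : nat).
Local Notation A := {mpoly k[n]}.
Local Notation VF := 'rV[A]_n.

Definition vf_act (eta : VF) (f : A) : A := \sum_(i < n) eta 0 i * mderiv i f.

Definition vf_bracket (eta xi : VF) : VF :=
  \row_j (vf_act eta (xi 0 j) - vf_act xi (eta 0 j)).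

Definition vf_coord (f : A) (i : 'I_n) : VF := \row_j ((j == i)%:R * f).

Definition vf_mon (m : 'X_{1..n}) (i : 'I_n) : VF := vf_coord 'X_[m] i.

Definition in_Lplus (eta : VF) : Prop :=
  forall i, (eta 0 i).@[fun _ => 0] = 0.

Definition mfact (m : 'X_{1..n}) : nat := (\prod_(i < n) (m i)`!)%N.

Definition is_AV_action (M : lmodType A) (act : VF -> M -> M) : Prop :=
  [/\ (forall eta m1 m2, act eta (m1 + m2) = act eta m1 + act eta m2),
      (forall (c : k) eta xi m,
          act (c%:MP *: eta + xi) m = c%:MP *: act eta m + act xi m),
      (forall eta xi m,
          act (vf_bracket eta xi) m = act eta (act xi m) - act xi (act eta m))
    & (forall eta (f : A) m, act eta (f *: m) = f *: act eta m + vf_act eta f *: m)].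

Definition fin_type_Amod (M : lmodType A) : Prop :=
  exists s : seq M, forall m : M,
    exists c : 'I_(size s) -> A, m = \sum_(j < size s) c j *: s`_j.

(* A (x) U with U = k^d is represented as column vectors 'cV[A]_d, and
   A-linear endomorphisms of it as matrices 'M[A]_d acting by left product. *)

Definition constv (d : nat) (u : 'cV[k]_d) : 'cV[A]_d := map_mx (fun c => c%:MP) u.

Definition covD (d : nat) (B : 'I_n -> 'M[A]_d) (i : 'I_n) (v : 'cV[A]_d) : 'cV[A]_d :=
  map_mx (mderiv i) v + B i *m v.

Definition is_Lplus_rep (d : nat) (rho : VF -> 'M[A]_d) : Prop :=
  [/\ (forall (c : k) eta xi, in_Lplus eta -> in_Lplus xi ->
          rho (c%:MP *: eta + xi) = c%:MP *: rho eta + rho xi),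
      (forall eta xi, in_Lplus eta -> in_Lplus xi ->
          rho (vf_bracket eta xi) = rho eta *m rho xi - rho xi *m rho eta)
    & (exists N : nat, forall (m : 'X_{1..n}) i, (N < mdeg m)%N -> rho (vf_mon m i) = 0)].

Definition is_gauge_fields (d : nat) (rho : VF -> 'M[A]_d) (B : 'I_n -> 'M[A]_d) : Prop :=
  (forall i j v, covD B i (covD B j v) = covD B j (covD B i v)) /\
  (forall i eta v, in_Lplus eta -> covD B i (rho eta *m v) = rho eta *m covD B i v).

(* right-hand side of the gauge-module formula for (f d/dx_i)(g u).
   The sum over k <> 0 is restricted to multi-indices of total degree
   < msize f; all omitted terms vanish since d^k f = 0 for them. *)
Definition gauge_rhs (d : nat) (rho : VF -> 'M[A]_d) (B : 'I_n -> 'M[A]_d)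
   (i : 'I_n) (f g : A) (u : 'cV[k]_d) : 'cV[A]_d :=
  (f * mderiv i g) *: constv u + (f * g) *: (B i *m constv u)
  + \sum_(m : 'X_{1..n < msize f} | m != 0%MM :> 'X_{1..n})
      (((mfact m)%:R^-1 : k)%:MP * g * mderivm m f) *: (rho (vf_mon m i) *m constv u).

End VF.

Arguments vf_act {k n}.
Arguments vf_bracket {k n}.
Arguments vf_coord {k n}.
Arguments vf_mon {k n}.
Arguments in_Lplus {k n}.
Arguments mfact {n}.
Arguments is_AV_action {k n M}.
Arguments fin_type_Amod {k n}.
Arguments constv {k n d}.
Arguments covD {k n d}.
Arguments is_Lplus_rep {k n d}.
Arguments is_gauge_fields {k n d}.
Arguments gauge_rhs {k n d}.

(* Main.v *)
(**
  The elements [sum_l (-1)^|l| binom(m, l) x^l (x^(m-l) d/dx_i)] with [m <> 0] act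
  A-linearly on an AV module, commute with the partial derivatives and span a copy of
  L_+; Taylor's formula recovers the action of [f d/dx_i] from them and from [d/dx_i].
  So everything reduces to the freeness of [M] over [A].  The ideal of those [a] for which
  the inclusion of the relation module in [A^s] has a retraction up to the factor [a] is
  nonzero and stable under the [d/dx_i], hence contains 1: [M] is projective, and the
  Quillen-Suslin theorem applies.  After a linear change of coordinates, a projective module
  becomes free once a polynomial monic in the last variable is inverted, so it is stably free
  by Schanuel's lemma, and Suslin's proof that unimodular rows with a monic entry are
  extended from the ring of coefficients gives cancellation.  Finally, [rho(x^m d/dx_i)] is
  an eigenvector of [ad rho(sum_j x_j d/dx_j)] with eigenvalue [|m| - 1], whence it vanishes
  for large [|m|].
*)
Require Import Defs.
From HB Require Import structures.
From mathcomp Require Import all_boot all_order all_algebra.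
From mathcomp Require Import perm fraction ssrcomplements mpoly ring.
From Stdlib Require Import Classical.
Set Implicit Arguments. Unset Strict Implicit. Unset Printing Implicit Defensive.
Import GRing.Theory.
Local Open Scope ring_scope.

(** * Free idempotent matrices *)

(** The alternating sums come from k[x, y], where the [x_i] multiply and [y^p] stands for the action
    of [x^p d/dx_i]: they are [(y - x)^m]. Vanishing on the diagonal y = x makes such an operator
    A-linear, dependence on y - x alone makes it commute with the partial derivatives, and Taylor's
    formula is the expansion of f(y) around x. Projective modules appear only as idempotent
    matrices, so that a change of ring is an entrywise map and an isomorphism is a pair of matrices.
    Algebraic closedness serves the freeness: it provides values outside a finite set, hence the
    monic coordinates, and it makes every residue field met in Suslin's argument equal to the ground
    field, so that coprimality can be tested on roots. *)

Definition mx_equiv (A : comNzRingType) s t (P : 'M[A]_s) (Q : 'M[A]_t) :=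
  exists (X : 'M[A]_(s, t)) (Y : 'M[A]_(t, s)), X *m Y = P /\ Y *m X = Q.

(** For idempotents [mx_equiv] is isomorphism of images, so the image of [P] is free of rank [d]. *)
Definition mx_free (A : comNzRingType) s (P : 'M[A]_s) :=
  exists d, mx_equiv P (1%:M : 'M[A]_d).

Definition idempotents_free (A : comNzRingType) :=
  forall s (P : 'M[A]_s), P *m P = P -> mx_free P.

(** [1 - w u] is the projector onto the kernel of the unimodular row [u] along the column [w]. *)
Definition kernels_free (A : comNzRingType) :=
  forall m (u : 'rV[A]_m) (w : 'cV[A]_m), u *m w = 1%:M ->
  mx_free (1%:M - w *m u).

Section Idempotents.
Variable A : comNzRingType.

Lemma mx_free_equiv s t (P : 'M[A]_s) (Q : 'M[A]_t) :
  P *m P = P -> mx_equiv P Q -> mx_free Q -> mx_free P.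
Proof.
move=> PP [X [Y [XY YX]]] [d [Z [W [ZW WZ]]]]; exists d, (X *m Z), (W *m Y).
split.
  by rewrite mulmxA -(mulmxA X) ZW -YX -!mulmxA XY mulmxA XY PP.
by rewrite mulmxA -(mulmxA W) YX -ZW -!mulmxA WZ mulmxA WZ mulmx1.
Qed.

(** In a basis of the image of [D], [e] becomes a unimodular row with section [Y e'], and [D - e' e]
    becomes the projector onto its kernel. *)
Lemma mx_free_sub_split s (D : 'M[A]_s) (e : 'rV[A]_s) (e' : 'cV[A]_s) :
  kernels_free A -> D *m D = D -> mx_free D -> e *m e' = 1%:M ->
  e *m D = e -> D *m e' = e' -> mx_free (D - e' *m e).
Proof.
move=> HU DD [d [X [Y [XY YX]]]] ee' eD De'.
have EE : (D - e' *m e) *m (D - e' *m e) = D - e' *m e.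
  rewrite mulmxBl !mulmxBr DD mulmxA De' -(mulmxA e' e D) eD.
  by rewrite -(mulmxA e') (mulmxA e) ee' mul1mx subrr subr0.
have uw : (e *m X) *m (Y *m e') = 1%:M.
  by rewrite mulmxA -(mulmxA e) XY eD.
apply: (mx_free_equiv EE _ (HU _ _ _ uw)).
exists ((D - e' *m e) *m X), (Y *m (D - e' *m e)); split.
  have DE : D *m (D - e' *m e) = D - e' *m e by rewrite mulmxBr DD mulmxA De'.
  by rewrite mulmxA -(mulmxA _ X) XY -mulmxA DE EE.
rewrite mulmxA -(mulmxA Y) EE mulmxBr mulmxBl -XY !mulmxA YX mul1mx YX.
by rewrite -!mulmxA.
Qed.

(** The free summand is removed one coordinate at a time: [D j] keeps [j] of them, and each step
    splits off one rank-one free summand. *)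
Lemma mx_free_unstabilize s q (P : 'M[A]_s) :
  kernels_free A -> P *m P = P ->
  mx_free (block_mx P 0 0 (1%:M : 'M[A]_q)) -> mx_free P.
Proof.
move=> HU PP F.
  pose D j : 'M[A]_(s + q) := block_mx P 0 0 (pid_mx j).
  have II j : D j *m D j = D j.
  by rewrite /D mulmx_block !mulmx0 !mul0mx !addr0 !add0r PP mul_pid_mx minnn pid_mx_minv.
have H j : (j <= q)%N -> mx_free (D (q - j)%N).
  elim: j => [|j IHj] jq; first by rewrite subn0 /D pid_mx_1.
  have lt : (q - j.+1 < q)%N by rewrite ltn_subrL (leq_trans _ jq).
  pose i := Ordinal lt.
  have Ei : pid_mx (q - j) - delta_mx i i = pid_mx (q - j.+1) :> 'M[A]_q.
    apply/matrixP=> a b; rewrite !mxE -!val_eqE /= -(subnSK jq) ltnS.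
    set c := (q - j.+1)%N; have [->|ab] := eqVneq (val a) (val b).
      by case: (ltngtP (b : nat) c) => //; rewrite ?subr0 ?subrr.
    have [ac|//] := eqVneq (val a) c; last by rewrite subr0.
    by rewrite eq_sym -ac (negbTE ab) subr0.
  have := @mx_free_sub_split _ _ (row_mx 0 (delta_mx 0 i)) (col_mx 0 (delta_mx i 0))
    HU (II (q - j)%N) (IHj (ltnW jq)).
  rewrite /D mul_row_col mul_row_block mul_block_col mul_col_row.
  rewrite !(mulmx0, mul0mx, add0r, addr0) !mul_delta_mx_cond eqxx !mulr1n.
  rewrite opp_block_mx add_block_mx !oppr0 !addr0 Ei; apply.
  - by apply/matrixP=> a b; rewrite !ord1 !mxE eqxx.
  - congr row_mx; rewrite -rowE; apply/rowP=> b; rewrite !mxE eqxx /=.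
    by rewrite -val_eqE /= eq_sym; case: eqP => //= _; rewrite ltn_sub2l.
  - congr col_mx; rewrite -colE; apply/colP=> b; rewrite !mxE eqxx andbT.
    by rewrite -val_eqE /=; case: eqP => //= ->; rewrite ltn_sub2l.
have := H q (leqnn q); rewrite subnn /D pid_mx_0; apply: mx_free_equiv => //.
exists (row_mx P 0), (col_mx P 0).
by rewrite mul_row_col mul_col_row !(mulmx0, mul0mx, addr0) PP.
Qed.

End Idempotents.

Lemma mx_free_map (A B : comNzRingType) (f : {rmorphism A -> B}) s (P : 'M[A]_s) :
  mx_free P -> mx_free (map_mx f P).
Proof.
case=> d [X [Y [XY YX]]]; exists d, (map_mx f X), (map_mx f Y).
by rewrite -!map_mxM XY YX map_mx1.
Qed.

Lemma mx_free_retract (A B : comNzRingType) (f : {rmorphism A -> B})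
  (g : {rmorphism B -> A}) s (P : 'M[A]_s) :
  cancel f g -> mx_free (map_mx f P) -> mx_free P.
Proof.
by move=> fK /(mx_free_map g); rewrite -map_mx_comp map_mx_id.
Qed.

(** * Stable freeness from a monic denominator *)

Lemma scalemx_inj (R : idomainType) m n (a : R) : a != 0 ->
  injective ( *:%R a : 'M[R]_(m, n) -> 'M[R]_(m, n)).
Proof.
move=> a0 U V /matrixP UV; apply/matrixP=> i j.
by have := UV i j; rewrite !mxE; apply: mulfI.
Qed.

Section Schanuel.
Variables (R : idomainType) (s d q : nat) (f : {poly R}).
Local Notation B := {poly R}.
Variables (P : 'M[B]_s) (X : 'M[B]_(d, s)) (Y : 'M[B]_(s, d)).
Variables (pi : 'rV[B]_d -> 'rV[R]_q) (sg : 'rV[R]_q -> 'rV[B]_d).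
Let inM (v : 'rV[B]_d) := exists m : 'rV[B]_s, m *m P = m /\ m *m Y = v.
Hypotheses (f0 : f != 0) (PP : P *m P = P) (YX : Y *m X = f *: P).

Hypothesis piD : forall c u v, pi (c%:P *: u + v) = c *: pi u + pi v.
Hypothesis sgD : forall c u v, sg (c *: u + v) = c%:P *: sg u + sg v.
Hypothesis piM : forall v, inM v <-> pi v = 0.
Hypothesis sgK : cancel sg pi.

Let piB u v : pi (u - v) = pi u - pi v.
Proof. by rewrite addrC -scaleN1r -polyC1 -polyCN piD scaleN1r addrC. Qed.

Let rows_inM m (N : 'M[B]_(m, d)) : (forall i, pi (row i N) = 0) ->
  exists V : 'M[B]_(m, s), V *m P = V /\ V *m Y = N.
Proof.
move=> N0; have /fin_all_exists [V HV] i := (piM _).2 (N0 i).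
exists (\matrix_i V i); split; apply/row_matrixP=> i;
  by rewrite row_mul rowK; case: (HV i).
Qed.

Let T : 'M[R]_q := \matrix_i pi ('X *: sg (delta_mx 0 i)).
Let C := char_poly_mx T.
(** [S0] and [L] lift the identity of the cokernel from one presentation to the other. Below, [V1]
    and [V2] express through [Y], and [W1] and [W2] through [C], the vectors that vanish in the
    cokernel. *)
Let S0 : 'M[B]_(q, d) := \matrix_i sg (delta_mx 0 i).
Let L : 'M[B]_(d, q) := map_mx polyC (\matrix_i pi (delta_mx 0 i)).

Let pi_sum n (a : 'rV[R]_n) (F : 'I_n -> 'rV[B]_d) :
  pi (\sum_i (a 0 i)%:P *: F i) = \sum_i a 0 i *: pi (F i).
Proof.
pose big := fun u v => pi u = v.
apply: (big_ind2 (fun u v => pi u = v)) => [|u1 v1 u2 v2 <- <-|i _].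
- by have := piB 0 0; rewrite !subrr.
- by rewrite -[u1]scale1r -polyC1 piD !scale1r.
- rewrite -[_ *: F i]addr0 piD; have := piB 0 0; rewrite !subrr => ->.
  by rewrite addr0.
Qed.

Let sgE (z : 'rV[R]_q) : map_mx polyC z *m S0 = sg z.
Proof.
rewrite mulmx_sum_row [in RHS](row_sum_delta z).
apply/esym; apply: (big_ind2 (fun u v => sg u = v)) => [|u1 v1 u2 v2 <- <-|i _].
- have := sgD (-1) 0 0; rewrite scaler0 addr0 => ->.
  by rewrite polyCN polyC1 scaleN1r addNr.
- by rewrite -[u1 in LHS]scale1r sgD polyC1 scale1r.
- rewrite -[_ *: delta_mx 0 i]addr0 sgD mxE rowK.
  have := sgD (-1) 0 0; rewrite scaler0 addr0 => ->.
  by rewrite polyCN polyC1 scaleN1r addNr addr0.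
Qed.

Let LE i : row i L = map_mx polyC (pi (delta_mx 0 i)).
Proof. by rewrite -map_row rowK. Qed.

Let exV1 : exists V1, V1 *m P = V1 /\ V1 *m Y = 1%:M - L *m S0.
Proof.
apply: rows_inM => i.
by rewrite linearB /= row1 row_mul LE sgE piB sgK subrr.
Qed.

Let pi_T z : pi ('X *: sg z) = z *m T.
Proof.
rewrite -sgE mulmx_sum_row scaler_sumr.
under eq_bigr => i _ do rewrite scalerA mulrC -scalerA mxE.
by rewrite pi_sum mulmx_sum_row; apply: eq_bigr => i _; rewrite !rowK.
Qed.

Let exV2 : exists V2, V2 *m P = V2 /\ V2 *m Y = - (C *m S0).
Proof.
apply: rows_inM => i; rewrite linearN /= row_mul.
have -> : row i C = 'X *: delta_mx 0 i - map_mx polyC (row i T).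
  by apply/rowP=> j; rewrite !mxE eqxx /= mulr_natr eq_sym.
rewrite mulmxBl sgE -scalemxAl -rowE rowK opprB piB sgK pi_T.
by rewrite -rowE subrr.
Qed.

(** Division with remainder by the matrix ['X - T]: modulo the rows of [C], multiplication by ['X]
    is [T], so every vector is congruent to a constant one. *)
Let divC (y : 'rV[B]_q) : exists w z, y = w *m C + map_mx polyC z.
Proof.
rewrite (row_sum_delta y).
pose D (y : 'rV[B]_q) := exists w z, y = w *m C + map_mx polyC z.
have DD u v : D u -> D v -> D (u + v).
  move=> [w [z ->]] [w' [z' ->]]; exists (w + w'), (z + z').
  by rewrite map_mxD mulmxDl addrACA.
have DC z : D (map_mx polyC z) by exists 0, z; rewrite mul0mx add0r.
have DX u : D u -> D ('X *: u).
  move=> [w [z ->]]; rewrite scalerDr scalemxAl; apply: (DD).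
    by exists ('X *: w), 0; rewrite map_mx0 addr0.
  exists (map_mx polyC z), (z *m T).
  by rewrite map_mxM -mulmxDr subrK mul_mx_scalar.
apply: (big_ind D) => [||i _]; last 1 first.
- elim/poly_ind: (y 0 i) => [|p c IHp].
    by rewrite scale0r -(map_mx0 polyC); apply: DC.
  rewrite scalerDl mulrC -scalerA; apply: DD; first exact: DX.
  have -> : c%:P *: delta_mx 0 i = map_mx polyC (c *: delta_mx 0 i) :> 'rV[B]_q.
    by rewrite map_mxZ map_delta_mx.
  exact: DC.
- by rewrite -(map_mx0 polyC); apply: DC.
- exact: DD.
Qed.

(** The rows of [C] span the kernel of the map from B^q to the cokernel: the constant remainder [z]
    has [sg z] in M, hence [z = pi (sg z) = 0]. *)
Let divC0 m (N : 'M[B]_(m, q)) (V : 'M[B]_(m, s)) :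
  V *m P = V -> N *m S0 = V *m Y -> exists W, N = W *m C.
Proof.
move=> VP NV; have [V2 [V2P V2Y]] := exV2.
have /fin_all_exists [w Hw] i : exists w, row i N = w *m C.
  have [w [z E]] := divC (row i N); exists w; rewrite {1}E.
  suff -> : z = 0 by rewrite map_mx0 addr0.
  rewrite -[z]sgK -sgE; have -> : map_mx polyC z = row i N - w *m C.
    by rewrite E addrC addKr.
  apply/piM; exists (row i V + w *m V2).
  rewrite mulmxDl -mulmxA V2P -row_mul VP; split=> //.
  by rewrite mulmxDl mulmxBl -!row_mul NV -!mulmxA V2Y mulmxN.
exists (\matrix_i w i); apply/row_matrixP=> i.
by rewrite row_mul rowK.
Qed.

Let C_inj m (W W' : 'M[B]_(m, q)) : W *m C = W' *m C -> W = W'.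
Proof.
move=> E; have := congr1 (fun Z => Z *m \adj C) E.
rewrite -!mulmxA mul_mx_adj !mul_mx_scalar.
by apply: scalemx_inj; rewrite monic_neq0 // char_poly_monic.
Qed.

Let Y_inj m (V V' : 'M[B]_(m, s)) :
  V *m P = V -> V' *m P = V' -> V *m Y = V' *m Y -> V = V'.
Proof.
move=> VP VP' E; have := congr1 (fun Z => Z *m X) E.
by rewrite -!mulmxA YX -!scalemxAr VP VP'; apply: scalemx_inj.
Qed.

(* Both sides are the fibre product of [B^d] and [B^q] over the [R]-module [R^q], on which
   ['X] acts by [T] and which is both the cokernel of [Y] and that of ['X - T]. *)
Lemma schanuel : mx_equiv (block_mx P 0 0 (1%:M : 'M_q)) (1%:M : 'M[B]_(d + q)).
Proof.
have [V1 [V1P V1Y]] := exV1; have [V2 [V2P V2Y]] := exV2.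
have LS : L *m S0 = 1%:M - V1 *m Y by rewrite V1Y opprB addrC subrK.
have [W1 HW1] : exists W1, - (P *m Y *m L) = W1 *m C.
  apply: (@divC0 _ _ (P *m Y *m V1 - P)).
    by rewrite mulmxBl PP -!mulmxA V1P.
  by rewrite mulNmx -(mulmxA (P *m Y)) LS mulmxBr mulmx1 opprB mulmxBl !mulmxA.
have [W2 HW2] : exists W2, 1%:M - S0 *m L = W2 *m C.
  apply: (@divC0 _ _ (S0 *m V1)); first by rewrite -mulmxA V1P.
  by rewrite mulmxBl mul1mx -(mulmxA S0 L) LS mulmxBr mulmx1 opprB addrC subrK mulmxA.
exists (block_mx (P *m Y) W1 S0 W2), (block_mx V1 L V2 C).
have HSL : S0 *m L = 1%:M - W2 *m C by rewrite -HW2 opprB addrC subrK.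
rewrite !mulmx_block scalar_mx_block; split; congr block_mx.
- apply: Y_inj; rewrite ?mulmxDl -?mulmxA ?V1P ?V2P //.
  by rewrite V1Y V2Y !mulmxBr mulmx1 mulmxN !mulmxA -HW1 !mulNmx opprK subrK.
- by rewrite -HW1 subrr.
- apply: Y_inj; rewrite ?mulmxDl ?mul0mx -?mulmxA ?V1P ?V2P //.
  by rewrite V1Y V2Y mulmxBr mulmx1 mulmxN !mulmxA -HW2 mulmxBl mul1mx subrr.
- by rewrite -HW2 addrC subrK.
- by rewrite mulmxA V1P V1Y subrK.
- apply: C_inj; rewrite mulmxDl -!mulmxA -HW1 -HW2 mul0mx mulmxN !mulmxA V1P V1Y.
  by rewrite mulmxBl mul1mx mulmxBr mulmx1 mulmxA addNr.
- by rewrite mulmxA V2P V2Y addNr.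
- apply: C_inj; rewrite mulmxDl -!mulmxA -HW1 -HW2 mulmxN !mulmxA V2P V2Y mul1mx.
  by rewrite mulNmx opprK mulmxBr mulmx1 !mulmxA addrC subrK.
Qed.

End Schanuel.

Lemma rV_linear_mx (R : comNzRingType) a b (f : 'rV[R]_a -> 'rV[R]_b) :
  (forall c u v, f (c *: u + v) = c *: f u + f v) ->
  exists M : 'M[R]_(a, b), forall u, u *m M = f u.
Proof.
move=> fL; pose F : {linear _ -> _} := HB.pack f (GRing.isLinear.Build _ _ _ _ f fL).
by exists (lin1_mx F) => u; rewrite mul_rV_lin1.
Qed.

Section StablyFree.
Variables (R : idomainType) (s d : nat) (f : {poly R}).
Local Notation B := {poly R}.
Variables (P : 'M[B]_s) (X : 'M[B]_(d, s)) (Y : 'M[B]_(s, d)).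
Hypotheses (RF : idempotents_free R) (fm : f \is monic) (PP : P *m P = P).
Hypotheses (XY : X *m Y = f%:M) (YX : Y *m X = f *: P).
Hypothesis (XP : X *m P = X).

Let fu : lead_coef f \is a GRing.unit.
Proof. by rewrite (monicP fm) unitr1. Qed.

(** The degree of [f]: remainders modulo [f] have at most [F] coefficients, so [coords] and [lift]
    identify B^d modulo [f] with R^(d F). *)
Let F := (size f).-1.
(* [inM] describes the image [M] of [P] inside [N = B^d].  As [f N] is contained in [M],
   the quotient by [f] provides a retraction [rho] of [N] onto [M] which is linear over [R]
   only; hence [N / M] is a projective [R]-module of finite rank. *)
Let quo m (v : 'rV[B]_m) := map_mx (fun p => p %/ f) v.
Let rem m (v : 'rV[B]_m) := map_mx (fun p => p %% f) v.
Let rho (v : 'rV[B]_d) := quo (v *m X) *m P *m Y.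
Let coords (v : 'rV[B]_d) : 'rV[R]_(d * F) :=
  mxvec (\matrix_(i, j) (v 0 i)`_j).
Let lift (z : 'rV[R]_(d * F)) : 'rV[B]_d :=
  \row_i rVpoly (row i (vec_mx z)).
(** [v - rho v] is zero on M, and the multiple of [f] dropped by [rem] lies in M; hence [gam] has
    kernel M and embeds N / M into R^(d F). *)
Let gam (v : 'rV[B]_d) := coords (rem (v - rho v)).

Let inM (v : 'rV[B]_d) := exists m : 'rV[B]_s, m *m P = m /\ m *m Y = v.

Let inMD u v : inM u -> inM v -> inM (u + v).
Proof.
by move=> [m [mP mY]] [n [nP nY]]; exists (m + n); rewrite !mulmxDl mP mY nP nY.
Qed.

Let inM_rho v : inM (rho v).
Proof. by exists (quo (v *m X) *m P); rewrite -mulmxA PP. Qed.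

Let rhoD c u v : rho (c%:P *: u + v) = c%:P *: rho u + rho v.
Proof.
have quoD (v1 v2 : 'rV[B]_s) : quo (c%:P *: v1 + v2) = c%:P *: quo v1 + quo v2.
  apply/rowP=> i; rewrite !mxE mul_polyC Pdiv.IdomainUnit.divpD //.
  by rewrite Pdiv.IdomainUnit.divpZl // mul_polyC.
by rewrite /rho mulmxDl -scalemxAl quoD !mulmxDl -!scalemxAl.
Qed.

Let rhoM v : inM v -> rho v = v.
Proof.
case=> m [mP <-]; rewrite /rho -(mulmxA m) YX -scalemxAr mP.
have -> : quo (f *: m) = m.
  by apply/rowP=> i; rewrite !mxE Pdiv.IdomainUnit.mulKp.
by rewrite mP.
Qed.

Let gamD c (u v : 'rV[B]_d) : gam (c%:P *: u + v) = c *: gam u + gam v.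
Proof.
rewrite /gam rhoD opprD addrACA -scalerBr; set a := u - _; set b := v - _.
rewrite -linearZ -linearD /=; congr mxvec; apply/matrixP=> i j.
rewrite !mxE mul_polyC Pdiv.IdomainUnit.modpD // Pdiv.IdomainUnit.modpZl //.
by rewrite coefD coefZ.
Qed.

Let gamM v : inM v -> gam v = 0.
Proof.
move=> /rhoM vE; rewrite /gam vE subrr; apply: (canLR vec_mxK); rewrite linear0.
by apply/matrixP=> i j; rewrite !mxE mod0p coef0.
Qed.

Let gamBM u v : inM v -> gam (u - v) = gam u.
Proof.
move=> vM; rewrite addrC -scaleN1r -[-1]/(- 1%:P) -polyCN gamD gamM //.
by rewrite scaler0 add0r.
Qed.

Let lift_coords (v : 'rV[B]_d) : (forall i : 'I_d, size (v 0%R i) <= F)%N -> lift (coords v) = v.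
Proof.
move=> sv; apply/rowP=> i; rewrite mxE mxvecK; apply/polyP=> j.
rewrite coef_rVpoly; case: insubP => [k kF kj|]; first by rewrite !mxE kj.
by rewrite -leqNgt => Fj; rewrite nth_default // (leq_trans (sv i)).
Qed.

Let inM_f (v : 'rV[B]_d) : inM (f *: v).
Proof.
exists (v *m X); rewrite -!mulmxA XP XY; split=> //.
by rewrite mul_mx_scalar.
Qed.

Let rem_quo (v : 'rV[B]_d) : v = rem v + f *: quo v.
Proof.
apply/rowP=> i; rewrite !mxE addrC mulrC.
exact: Pdiv.IdomainUnit.divp_eq.
Qed.

Let gam_idem (v : 'rV[B]_d) : gam (lift (gam v)) = gam v.
Proof.
rewrite {2}/gam lift_coords; last first.
  move=> i; rewrite mxE -ltnS prednK ?ltn_modp ?monic_neq0 //.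
  by rewrite size_poly_gt0 monic_neq0.
have -> : rem (v - rho v) = v - (rho v + f *: quo (v - rho v)).
  by rewrite opprD addrA {2}[v - rho v]rem_quo addrK.
by rewrite gamBM //; apply: inMD (inM_f _); exact: inM_rho.
Qed.

Let gam_eq0 (v : 'rV[B]_d) : gam v = 0 -> inM v.
Proof.
move=> g0; have r0 : rem (v - rho v) = 0.
  rewrite -[LHS]lift_coords -/(gam v) ?g0.
    by apply/rowP=> i; rewrite !mxE linear0 row0 linear0.
  move=> i; rewrite mxE -ltnS prednK ?ltn_modp ?monic_neq0 //.
  by rewrite size_poly_gt0 monic_neq0.
rewrite -[v](subrK (rho v)) [v - rho v]rem_quo r0 add0r.
by apply: inMD; [exact: inM_f | exact: inM_rho].
Qed.

Let liftD c u v : lift (c *: u + v) = c%:P *: lift u + lift v.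
Proof. by apply/rowP=> i; rewrite !mxE mul_polyC !linearP. Qed.

(** The composite of [lift] and [gam] is an idempotent matrix over [R] with image N / M, and
    idempotents over [R] are free by hypothesis. *)
Let quotient_free : exists q (pi : 'rV[B]_d -> 'rV[R]_q) (sg : 'rV[R]_q -> 'rV[B]_d),
  [/\ forall c u v, pi (c%:P *: u + v) = c *: pi u + pi v,
      forall c u v, sg (c *: u + v) = c%:P *: sg u + sg v,
      forall v, inM v <-> pi v = 0 & cancel sg pi].
Proof.
have [E EE] : exists E : 'M[R]_(d * F), forall z, z *m E = gam (lift z).
  by apply: rV_linear_mx => c u v; rewrite liftD gamD.
have Ei : E *m E = E.
  by apply/row_matrixP=> i; rewrite !rowE mulmxA !EE gam_idem.
have [q [U [V [UV VU]]]] := RF Ei.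
exists q, (fun v => gam v *m U), (fun z => lift (z *m V)); split.
- by move=> c u v; rewrite gamD mulmxDl -scalemxAl.
- by move=> c u v; rewrite mulmxDl -scalemxAl liftD.
- move=> v; split=> [/gamM -> | gU]; first by rewrite mul0mx.
  by apply: gam_eq0; rewrite -gam_idem -EE -UV mulmxA gU mul0mx.
- by move=> z; rewrite -EE -UV mulmxA -(mulmxA z) VU mulmx1 -mulmxA VU mulmx1.
Qed.

Lemma normalized_stably_free : exists q, mx_free (block_mx P 0 0 (1%:M : 'M[B]_q)).
Proof.
have [q [pi [sg [piD sgD piM sgK]]]] := quotient_free.
by exists q, (d + q)%N; exact: (schanuel (monic_neq0 fm) PP YX piD sgD piM sgK).
Qed.

End StablyFree.

Lemma monic_stably_free (R : idomainType) s d (f : {poly R}) (P : 'M_s)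
    (X : 'M_(d, s)) (Y : 'M_(s, d)) :
  idempotents_free R -> f \is monic -> P *m P = P ->
  X *m Y = f%:M -> Y *m X = f *: P ->
  exists q, mx_free (block_mx P 0 0 (1%:M : 'M_q)).
Proof.
move=> RF fm PP XY YX.
have f0 : f != 0 by apply: monic_neq0.
apply: (@normalized_stably_free R s d f P (X *m P) (P *m Y)) => //.
(* [f X P Y = X (Y X) Y = f^2], and one factor [f] cancels. *)
- rewrite mulmxA -(mulmxA X) PP; apply: (scalemx_inj f0).
  by rewrite -mulmxA scalemxAr scalemxAl -YX !mulmxA XY -mulmxA XY -!scalar_mxM scale_scalar_mx.
- by rewrite mulmxA -(mulmxA P Y) YX -scalemxAr -scalemxAl !PP.
- by rewrite -mulmxA PP.
Qed.

(** * Suslin's theorem on unimodular rows *)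

(** The kernel of [phi] plays the role of a maximal ideal containing [J], and surjectivity
    identifies its residue field with [K]; no quotient ring has to be formed. *)
Definition nullstellensatz (K : fieldType) (R : comNzRingType) :=
  forall J : R -> Prop, J 0 -> (forall x y, J x -> J y -> J (x + y)) ->
    (forall a x, J x -> J (a * x)) -> ~ J 1 ->
  exists phi : {rmorphism R -> K},
    (forall c, exists r, phi r = c) /\ forall x, J x -> phi x = 0.

Lemma closed_nonroot (K : closedFieldType) (p : {poly K}) :
  p != 0 -> exists x, p.[x] != 0.
Proof.
move=> p0; case: (leqP (size p) 1) => [/size1_polyC E|sp].
  by exists 0; rewrite E hornerC -polyC_eq0 -E.
have [|x] := closed_rootP (p - 1) _.
  by rewrite size_polyDl ?size_polyN ?size_poly1 // gtn_eqF.
by rewrite rootE hornerD hornerN hornerC subr_eq0 => /eqP E; exists x; rewrite E oner_eq0.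
Qed.

(** At each root [z] of [a], [b(z) + g(z) h] is a nonzero polynomial in [h]; the product of these
    over all roots has a non-root. *)
Lemma avoid_common_roots (K : closedFieldType) (a b g : {poly K}) : a != 0 ->
  (forall x, root a x -> root b x -> ~~ root g x) ->
  exists h, forall x, root a x -> ~~ root (b + h *: g) x.
Proof.
move=> a0 abg; have [r ar] := closed_field_poly_normal a.
have mem_r x : root a x = (x \in r).
  by rewrite ar rootZ ?lead_coef_eq0 // root_prod_XsubC.
pose q := \prod_(z <- r) (b.[z]%:P + g.[z] *: 'X).
have [|h qh] := @closed_nonroot K q.
  rewrite prodf_seq_neq0; apply/allP=> z zr /=; apply/eqP=> E.
  have := abg z; rewrite mem_r zr !rootE => /(_ isT).
  have := congr1 (coefp 0) E; have := congr1 (coefp 1) E.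
  rewrite /= !coefD !coefZ !coefX !coefC /= mulr1 mulr0 addr0 add0r => -> ->.
  by rewrite eqxx => /(_ isT).
exists h => x; rewrite mem_r => xr; rewrite rootE hornerD hornerZ.
move: qh; rewrite horner_prod prodf_seq_neq0 => /allP/(_ x xr) /=.
by rewrite hornerD hornerZ hornerC hornerX mulrC.
Qed.

(** The constant is a resultant, which lies in the ideal of the two polynomials and whose image
    under [phi] is nonzero because the images have no common root. *)
Lemma elimination (K : closedFieldType) (R : comNzRingType)
    (phi : {rmorphism R -> K}) (f g : {poly R}) : f \is monic ->
  (forall x, root (map_poly phi f) x -> ~~ root (map_poly phi g) x) ->
  exists al be c, c%:P = al * f + be * g /\ phi c != 0.
Proof.
move=> fm nr; case: (leqP (size f) 1) => [sf|sf].
  exists 1, 0, 1; split; last by rewrite rmorph1 oner_neq0.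
  rewrite mul1r mul0r addr0; move/monicP: fm.
  by rewrite (size1_polyC sf) lead_coefC => ->.
(* Adding [f * 'X^N] makes the second polynomial monic without changing its values at the roots of
   [f]. Both sizes are then preserved by [phi], which therefore commutes with the resultant. *)
pose N := size g; pose g' := g + f * 'X^N.
have sfX : size (f * 'X^N) = (size f + N)%N.
  by rewrite mulrC size_monicM ?monicXn ?size_polyXn ?monic_neq0 // addSn addnC.
have sg' : (size g < size (f * 'X^N : {poly R})%R)%N by rewrite sfX -{1}[size g]add0n ltn_add2r ltnW.
have g'm : g' \is monic.
  by rewrite monicE /g' lead_coefDr // -monicE monicMr ?monicXn.
have sg1 : (1 < size g')%N by rewrite /g' addrC size_polyDl // sfX ltn_addr.
have [[u v] /= _ E] := resultant_in_ideal sf sg1.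
exists (u + v * 'X^N), v, (resultant f g'); split.
  by rewrite E /g' mulrDr mulrDl [in RHS]addrAC mulrA -!addrA (mulrAC v) addrC -addrA [_ + u * f]addrC.
have sm (p : {poly R}) : p \is monic -> size (map_poly phi p) = size p.
  by move=> /monicP pm; rewrite size_map_poly_id0 // pm rmorph1 oner_neq0.
have -> : phi (resultant f g') = resultant (map_poly phi f) (map_poly phi g').
  rewrite /resultant /Sylvester_mx !sm // -det_map_mx map_col_mx.
  by congr (\det (col_mx _ _)); apply: map_lin1_mx => z;
    rewrite map_poly_rV rmorphM /= map_rVpoly.
rewrite resultant_eq0 -leqNgt leqNgt; apply/negP=> sgc.
have [|x rx] := closed_rootP (gcdp (map_poly phi f) (map_poly phi g')) _.
  by rewrite gtn_eqF.
move: rx; rewrite root_gcd => /andP[rf].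
rewrite rmorphD rmorphM /= rootE hornerD hornerM (eqP rf) mul0r addr0.
by rewrite -rootE (negbTE (nr x rf)).
Qed.

Section Suslin.
Variable R : idomainType.
Local Notation B := {poly R}.

(** For fixed [u] these [c] form an ideal of [R]: sums use the freedom in [b], multiples the freedom
    in [e]. Once the ideal contains 1, [b = 0] and [e = 'X] carry [u] to its constant row. *)
Definition shift_equiv m (u : 'rV[B]_m) (c : R) := forall b e : B,
  exists2 G, G \in unitmx &
    map_mx (comp_poly (b + c%:P * e)) u *m G = map_mx (comp_poly b) u.

Lemma comp_poly_shift (p b e : B) (c : R) :
  exists z, p \Po (b + c%:P * e) = p \Po b + c%:P * z.
Proof.
elim/poly_ind: p => [|p a [z IH]].
  by exists 0; rewrite !comp_poly0 mulr0 addr0.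
exists (e * (p \Po b) + z * b + z * (c%:P * e)).
by rewrite !comp_polyD !comp_polyM !comp_polyX !comp_polyC IH; ring.
Qed.

Lemma comp_mx_shift m n (M : 'M[B]_(m, n)) (b e : B) (c : R) :
  exists Z, map_mx (comp_poly (b + c%:P * e)) M =
            map_mx (comp_poly b) M + c%:P *: Z.
Proof.
have /fin_all_exists [Z HZ] i : exists z : 'I_n -> B, forall j,
    M i j \Po (b + c%:P * e) = M i j \Po b + c%:P * z j.
  exact: (fin_all_exists (fun j => comp_poly_shift (M i j) b e c)).
by exists (\matrix_(i, j) Z i j); apply/matrixP=> i j; rewrite !mxE.
Qed.

Lemma shift_equivD m (u : 'rV[B]_m) c c' :
  shift_equiv u c -> shift_equiv u c' -> shift_equiv u (c + c').
Proof.
move=> uc uc' b e; have [G Gu HG] := uc (b + c'%:P * e) e.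
have [G' G'u HG'] := uc' b e; exists (G *m G'); first by rewrite unitmx_mul Gu.
by rewrite mulmxA -HG' -HG polyCD mulrDl [c%:P * e + _]addrC addrA.
Qed.

Lemma shift_equivM m (u : 'rV[B]_m) a c :
  shift_equiv u c -> shift_equiv u (a * c).
Proof.
by move=> uc b e; have := uc b (a%:P * e); rewrite mulrA -polyCM [c * a]mulrC.
Qed.

Lemma shift_equiv0 m (u : 'rV[B]_m) : shift_equiv u 0.
Proof. by move=> b e; exists 1%:M; rewrite ?unitmx1 // mulmx1 mul0r addr0. Qed.

Lemma shift_equiv_unit m (u : 'rV[B]_m) E c :
  E \in unitmx -> shift_equiv (u *m E) c -> shift_equiv u c.
Proof.
move=> Eu uE b e; have [G Gu] := uE b e; rewrite !map_mxM => HG.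
have Eb x : map_mx (comp_poly x) E \in unitmx.
  by rewrite unitmxE det_map_mx rmorph_unit -?unitmxE.
exists (map_mx (comp_poly (b + c%:P * e)) E *m G *m invmx (map_mx (comp_poly b) E)).
  by rewrite !unitmx_mul Eb Gu unitmx_inv Eb.
by rewrite !mulmxA HG mulmxK //; apply: Eb.
Qed.

(* The transition matrix [Z(b') * Z'(b) / c] has polynomial entries because [Z * Z' = c]. *)
Lemma shift_equiv_pair m (f w al be : B) (r : 'rV[B]_m) c : c != 0 ->
  c%:P = al * f + be * w -> shift_equiv (row_mx (row_mx f%:M w%:M) r) c.
Proof.
move=> c0 cE b e; set b' := b + _.
pose p : 'rV[B]_(1 + 1) := row_mx f%:M w%:M.
pose Z : 'M[B]_(1 + 1) := block_mx al%:M (- w)%:M be%:M f%:M.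
pose Z' : 'M[B]_(1 + 1) := block_mx f%:M w%:M (- be)%:M al%:M.
have ZZ : Z *m Z' = (c%:P)%:M.
  rewrite mulmx_block -!scalar_mxM -!raddfD scalar_mx_block cE.
  by congr block_mx; rewrite -?(raddf0 (@scalar_mx _ 1)); congr (_%:M); ring.
have Z'Z : Z' *m Z = (c%:P)%:M.
  rewrite mulmx_block -!scalar_mxM -!raddfD scalar_mx_block cE.
  by congr block_mx; rewrite -?(raddf0 (@scalar_mx _ 1)); congr (_%:M); ring.
have pZ : p *m Z = row_mx (c%:P)%:M 0.
  rewrite mul_row_block -!scalar_mxM -!raddfD cE -(raddf0 (@scalar_mx _ 1)).
  by congr row_mx; congr (_%:M); ring.
have pZ' : row_mx 1%:M 0 *m Z' = p by rewrite mul_row_block !mul1mx !mul0mx !addr0.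
pose ev x m n : 'M[B]_(m, n) -> 'M[B]_(m, n) := map_mx (comp_poly x).
have c0' : c%:P != 0 :> B by rewrite polyC_eq0.
have [F HF] := comp_mx_shift Z b e c; have [F' HF'] := comp_mx_shift Z' b e c.
have [Fr HFr] := comp_mx_shift r b e c.
pose S := 1%:M + F *m ev b _ _ Z'; pose S' := 1%:M + ev b _ _ Z *m F'.
have SE : c%:P *: S = ev b' _ _ Z *m ev b _ _ Z'.
  by rewrite /ev HF mulmxDl -map_mxM ZZ map_scalar_mx /= comp_polyC scalerDr scalemx1 scalemxAl.
have S'E : c%:P *: S' = ev b _ _ Z *m ev b' _ _ Z'.
  by rewrite /ev HF' mulmxDr -map_mxM ZZ map_scalar_mx /= comp_polyC scalerDr scalemx1 scalemxAr.
have SS' : S *m S' = 1%:M.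
  do 2!apply: (scalemx_inj c0'); rewrite scalemxAl scalemxAr SE S'E mulmxA.
  rewrite -(mulmxA (ev b' _ _ Z)) -map_mxM Z'Z map_scalar_mx /= comp_polyC mul_mx_scalar -scalemxAl.
  by rewrite -map_mxM ZZ map_scalar_mx /= comp_polyC scalemx1.
have pS : ev b' _ _ p *m S = ev b _ _ p.
  apply: (scalemx_inj c0'); rewrite scalemxAr SE mulmxA -map_mxM pZ.
  rewrite map_row_mx map_scalar_mx map_mx0 /= comp_polyC -pZ' /ev map_mxM.
  by rewrite map_row_mx map_mx1 map_mx0 scalemxAl scale_row_mx scalemx1 scaler0.
(* The remaining entries [r] change by a multiple of [c], and [p * a = c]; column operations with
   [a], evaluated at [b'], undo that change. *)
pose a : 'cV[B]_(1 + 1) := col_mx al%:M be%:M.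
have pa : ev b' _ _ p *m ev b' _ _ a = (c%:P)%:M.
  rewrite /ev -map_mxM mul_row_col -!scalar_mxM -raddfD map_scalar_mx /=.
  by rewrite (_ : _ + _ = c%:P) ?comp_polyC // cE; ring.
exists (block_mx S (- ev b' _ _ a *m Fr) 0 1%:M).
  by rewrite unitmxE det_ublock det1 mulr1 -unitmxE; have [] := mulmx1_unit SS'.
have mrow x : map_mx (comp_poly x) (row_mx p r) = row_mx (ev x _ _ p) (ev x _ _ r).
  exact: map_row_mx.
rewrite -/p !mrow mul_row_block pS mulmx0 addr0 mulmx1 mulmxA mulmxN pa mulNmx.
by rewrite mul_scalar_mx /ev HFr addrC addrK.
Qed.

(** If the ideal were proper, some [phi] would kill it. Over [K] the entries [f], [w0] and the
    combination [g] of the others have no common root by unimodularity, so adding a multiple of [g]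
    to [w0] leaves [f] and the new entry coprime. Elimination then puts in the ideal an element that
    [phi] does not kill. *)
Theorem shift_equiv_monic (K : closedFieldType) m (f w0 : B) (r : 'rV[B]_m)
    (w : 'cV[B]_(1 + 1 + m)) :
  nullstellensatz K R -> f \is monic ->
  row_mx (row_mx f%:M w0%:M) r *m w = 1%:M ->
  shift_equiv (row_mx (row_mx f%:M w0%:M) r) 1.
Proof.
move=> NS fm uw; apply: NNPP => n1.
have [phi [phis phi0]] := NS _ (shift_equiv0 _) (@shift_equivD _ _)
  (@shift_equivM _ _) n1.
have mf : map_poly phi f \is monic by apply: monic_map.
pose g := (r *m dsubmx w) 0 0.
have [|x ra rb|h Hh] := @avoid_common_roots K (map_poly phi f) (map_poly phi w0)
  (map_poly phi g); first exact: monic_neq0.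
  apply/negP=> rg; have := congr1 (fun M : 'M_1 => map_poly phi (M 0 0)) uw.
  rewrite -{1}[w]vsubmxK mul_row_col mxE -/g -{1}[usubmx w]vsubmxK mul_row_col.
  rewrite !mul_scalar_mx !mxE !rmorphD !rmorphM rmorph1 /= => /(congr1 (horner^~ x)).
  rewrite !hornerD !hornerM (eqP ra) (eqP rb) (eqP rg) !mul0r !addr0 hornerC.
  by move/eqP; rewrite eq_sym oner_eq0.
have [rh rhE] := phis h.
have [|al [be [c [cE phic]]]] := @elimination K R phi f (w0 + rh%:P * g) fm.
  by move=> x /Hh; rewrite rmorphD rmorphM /= map_polyC /= rhE mul_polyC.
have c0 : c != 0 by apply: contraNneq phic => ->; rewrite rmorph0.
case/eqP: phic; apply: phi0.
pose V : 'M[B]_(m, 1 + 1) := row_mx 0 (rh%:P *: dsubmx w).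
apply: (@shift_equiv_unit _ _ (block_mx 1%:M 0 V 1%:M)).
  by rewrite unitmxE det_lblock !det1 mulr1 unitr1.
rewrite mul_row_block !mulmx1 mulmx0 add0r mul_mx_row mulmx0 add_row_mx addr0.
rewrite -scalemxAr [r *m _]mx11_scalar -/g scale_scalar_mx -raddfD.
exact: shift_equiv_pair cE.
Qed.

(** * Kernels of unimodular rows over a polynomial ring *)

Lemma kernel_mul (A : comNzRingType) m (u : 'rV[A]_m) (v v' : 'cV[A]_m) :
  u *m v = 1%:M ->
  (1%:M - v' *m u) *m (1%:M - v *m u) = 1%:M - v *m u.
Proof.
move=> uv; rewrite mulmxBl mul1mx mulmxBr mulmx1 -(mulmxA v') (mulmxA u) uv.
by rewrite mul1mx subrr subr0.
Qed.

Lemma kernel_free_unit (A : comUnitRingType) m (u : 'rV[A]_m) (w : 'cV[A]_m) G :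
  G \in unitmx -> u *m w = 1%:M ->
  mx_free (1%:M - (invmx G *m w) *m (u *m G)) -> mx_free (1%:M - w *m u).
Proof.
move=> Gu uw; have I := kernel_mul w uw; apply: mx_free_equiv => //.
exists ((1%:M - w *m u) *m G), (invmx G *m (1%:M - w *m u)); split.
  by rewrite mulmxA mulmxK.
rewrite mulmxA -(mulmxA _ _ (1%:M - w *m u)) I mulmxBr mulmxBl mulmx1 mulVmx //.
by rewrite !mulmxA.
Qed.

Lemma kernel_free_section (A : comNzRingType) m (u : 'rV[A]_m) (w w' : 'cV[A]_m) :
  u *m w = 1%:M -> u *m w' = 1%:M ->
  mx_free (1%:M - w' *m u) -> mx_free (1%:M - w *m u).
Proof.
move=> uw uw'; apply: mx_free_equiv; first exact: kernel_mul.
by exists (1%:M - w' *m u), (1%:M - w *m u); rewrite !kernel_mul.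
Qed.

(** The shift by ['X] from 0 turns [u] into its constant row, whose kernel is extended from [R],
    where it is free by hypothesis. *)
Lemma head_monic_kernel_free (K : closedFieldType) m (f w0 : B) (r : 'rV[B]_m)
    (w : 'cV[B]_(1 + 1 + m)) (u := row_mx (row_mx f%:M w0%:M) r) :
  nullstellensatz K R -> idempotents_free R -> f \is monic ->
  u *m w = 1%:M -> mx_free (1%:M - w *m u).
Proof.
move=> NS RF fm uw; have := shift_equiv_monic NS fm uw; rewrite -/u.
move=> /(_ 0 'X) [H Hu]; rewrite add0r polyC1 mul1r map_mx_id; last first.
  by move=> p /=; rewrite comp_polyXr.
move=> E; apply: (kernel_free_unit Hu) => //; rewrite E.
pose u0 := map_mx (horner_eval 0) u; pose v0 := map_mx (horner_eval 0) w.
have E0 : map_mx (comp_poly 0) u = map_mx polyC u0.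
  by rewrite -map_mx_comp; apply: eq_map_mx => p /=; rewrite -comp_polyCr.
have uv0 : u0 *m v0 = 1%:M by rewrite -map_mxM uw map_mx1.
rewrite E0; apply: (@kernel_free_section _ _ _ _ (map_mx polyC v0)).
- by rewrite -E0 -E mulmxA mulmxK.
- by rewrite -map_mxM uv0 map_mx1.
rewrite -map_mxM -(map_mx1 polyC) -map_mxB; apply: mx_free_map; apply: RF.
exact: kernel_mul.
Qed.

Theorem monic_kernel_free (K : closedFieldType) m (u : 'rV[B]_m) (w : 'cV[B]_m) i :
  nullstellensatz K R -> idempotents_free R ->
  u 0 i \is monic -> u *m w = 1%:M -> mx_free (1%:M - w *m u).
Proof.
move=> NS RF; case: m u w i => [|[|m]] u w i fm uw; first by case: (i).
  exists 0, 0, 0; split; last by apply/matrixP; case.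
  have : w 0 0 * u 0 0 = 1.
    by have := congr1 (fun M : 'M_1 => M 0 0) uw; rewrite !mxE big_ord1 mulrC.
  move=> E; rewrite mul0mx; apply/matrixP=> a b.
  by rewrite !ord1 !mxE big_ord1 E subrr.
pose j : 'I_(1 + 1 + m) := lshift m (lshift 1 0).
pose G : 'M[B]_(1 + 1 + m) := tperm_mx i j.
have Gu : G \in unitmx by apply: unitmx_perm.
apply: (kernel_free_unit Gu) => //.
have : (u *m G) *m (invmx G *m w) = 1%:M by rewrite mulmxA mulmxK.
have : (u *m G) 0 j \is monic by rewrite -xcolE mxE tpermR.
move: (u *m G) (invmx G *m w) => u' w' fm' u'w'.
have vE : u' = row_mx (row_mx (u' 0 j)%:M ((rsubmx (lsubmx u')) 0 0)%:M) (rsubmx u').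
  rewrite -[LHS]hsubmxK -[lsubmx u' in LHS]hsubmxK; congr (row_mx (row_mx _ _) _).
    by rewrite [LHS]mx11_scalar !mxE.
  by rewrite -mx11_scalar.
move: vE fm'; move: (u' 0 j) (rsubmx (lsubmx u') 0 0) (rsubmx u') => f w0 r.
by move=> u'E fm'; move: u'w'; rewrite u'E; apply: (head_monic_kernel_free NS).
Qed.

End Suslin.

(** * Coordinates and generic freeness *)

Lemma field_idempotents_free (K : fieldType) : idempotents_free K.
Proof.
move=> s P PP; exists (\rank P), (col_base P), (row_base P).
rewrite mulmx_base; split=> //.
have [U UC] := row_fullP (col_base_full P).
have [V RV] := row_freeP (row_base_free P).
move: (\rank P) (col_base P) (row_base P) U V UC RV (mulmx_base P).
move=> r C Q U V UC QV CQ; have := congr1 (fun M => U *m M *m V) PP.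
by rewrite -CQ /= !mulmxA UC !mul1mx QV -mulmxA QV mulmx1.
Qed.

Lemma fraction_denominator (A : idomainType) (x : {fraction A}) :
  exists a b : A, b != 0 /\ x * tofrac b = tofrac a.
Proof.
elim/quotW: x => r; exists (frac r).1, (frac r).2; split; first exact: denom_ratioP.
unlock tofrac; rewrite -[LHS]FracField.pi_mul; apply/eqmodP.
rewrite /= FracField.equivfE /FracField.mulf.
by rewrite !numden_Ratio ?oner_eq0 ?mulr1 ?mulf_neq0 ?denom_ratioP // mulrC.
Qed.

Lemma common_denominator (A : idomainType) m n (M : 'M[{fraction A}]_(m, n)) :
  exists (b : A) (N : 'M[A]_(m, n)), b != 0 /\ tofrac b *: M = map_mx (@tofrac A) N.
Proof.
have /fin_all_exists [a Ha] p := fraction_denominator (M p.1 p.2).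
have {Ha} /fin_all_exists [d Hd] p := Ha p.
pose b := \prod_p d p; exists b.
exists (\matrix_(i, j) (a (i, j) * \prod_(p | p != (i, j)) d p)).
split; first by apply/prodf_neq0 => p _; have [] := Hd p.
apply/matrixP=> i j; rewrite !mxE /b (bigD1 (i, j)) //= !rmorphM /=.
by have [_ /= <-] := Hd (i, j); rewrite mulrC mulrA.
Qed.

Lemma map_tofrac_inj (A : idomainType) m n :
  injective (map_mx (@tofrac A) : 'M_(m, n) -> 'M_(m, n)).
Proof.
move=> U V /matrixP UV; apply/matrixP=> i j; apply/eqP.
by have := UV i j; rewrite !mxE => /eqP; rewrite tofrac_eq.
Qed.

(** The image is free over the fraction field; [f] is the product of common denominators of the two
    mutually inverse maps. *)
Lemma generically_free (A : idomainType) s (P : 'M[A]_s) : P *m P = P ->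
  exists (f : A) d (X : 'M_(d, s)) (Y : 'M_(s, d)),
    [/\ f != 0, X *m Y = f%:M & Y *m X = f *: P].
Proof.
move=> PP; have PPF : map_mx (@tofrac A) P *m map_mx (@tofrac A) P = map_mx (@tofrac A) P.
  by rewrite -map_mxM PP.
have [d [Y' [X' [YX' XY']]]] := field_idempotents_free PPF.
have [a [Y [a0 HY]]] := common_denominator Y'.
have [b [X [b0 HX]]] := common_denominator X'.
exists (a * b), d, X, Y; rewrite mulf_neq0 //.
split=> //; apply: map_tofrac_inj; rewrite map_mxM -HX -HY -scalemxAr -scalemxAl scalerA.
  by rewrite XY' map_scalar_mx /= rmorphM scalemx1.
by rewrite YX' map_mxZ /= rmorphM mulrC.
Qed.

Lemma mpoly_rmorph_ext (A B : comNzRingType) n (f g : {rmorphism {mpoly A[n]} -> B}) :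
  (forall c, f c%:MP = g c%:MP) -> (forall i, f 'X_i = g 'X_i) -> f =1 g.
Proof.
move=> fgC fgX p; rewrite (mpolyE p) !rmorph_sum; apply: eq_bigr => m _.
rewrite -mul_mpolyC !rmorphM fgC mpolyXE_id; congr (_ * _).
by rewrite !rmorph_prod; apply: eq_bigr => i _; rewrite !rmorphXn fgX.
Qed.

Lemma poly_rmorph_ext (A B : comNzRingType) (f g : {rmorphism {poly A} -> B}) :
  (forall c, f c%:P = g c%:P) -> f 'X = g 'X -> f =1 g.
Proof.
by move=> fgC fgX; elim/poly_ind => [|p c IH]; rewrite ?rmorph0 // !rmorphD !rmorphM fgC fgX IH.
Qed.

Section Coordinates.
Variables (K : fieldType) (n : nat) (lam : 'I_n.+1 -> K).
Hypothesis lam0 : lam ord_max != 0.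
Local Notation A := {mpoly K[n]}.
Local Notation A' := {mpoly K[n.+1]}.

(** The new last variable runs along the direction [lam]. A polynomial of degree [d] then has as
    coefficient of ['X^d] the value at [lam] of its homogeneous part of degree [d], a constant. *)
Definition split_var (i : 'I_n.+1) : {poly A} :=
  (if unlift ord_max i is Some j then ('X_j)%:P else 0) + (lam i)%:MP *: 'X.

Definition split_coords : {rmorphism A' -> {poly A}} :=
  mmap (polyC \o @mpolyC n K) split_var.

Definition embed_coords : {rmorphism A -> A'} :=
  mmap (@mpolyC n.+1 K)
    (fun j => 'X_(lift ord_max j) - (lam (lift ord_max j) / lam ord_max)%:MP * 'X_ord_max).

Definition merge_coords : {rmorphism {poly A} -> A'} :=
  horner_eval ((lam ord_max)^-1%:MP * 'X_ord_max) \o map_poly embed_coords.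

Lemma split_coordsC c : split_coords c%:MP = c%:MP%:P.
Proof. by rewrite /split_coords /= mmapC. Qed.

Lemma split_coordsX i : split_coords 'X_i = split_var i.
Proof. by rewrite /split_coords /= mmapX mmap1U. Qed.

Lemma embed_coordsC c : embed_coords c%:MP = c%:MP.
Proof. by rewrite /embed_coords /= mmapC. Qed.

Lemma embed_coordsX j : embed_coords 'X_j =
  'X_(lift ord_max j) - (lam (lift ord_max j) / lam ord_max)%:MP * 'X_ord_max.
Proof. by rewrite /embed_coords /= mmapX mmap1U. Qed.

Lemma merge_coordsC p : merge_coords p%:P = embed_coords p.
Proof. by rewrite /merge_coords /= map_polyC /= /horner_eval hornerC. Qed.

Lemma merge_coordsX : merge_coords 'X = (lam ord_max)^-1%:MP * 'X_ord_max.
Proof. by rewrite /merge_coords /= map_polyX /horner_eval hornerX. Qed.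

Lemma split_coordsK : cancel split_coords merge_coords.
Proof.
apply: (@mpoly_rmorph_ext _ _ _ (merge_coords \o split_coords) idfun) => [c|i].
  by rewrite -[LHS]/(merge_coords (split_coords _)) split_coordsC merge_coordsC embed_coordsC.
rewrite -[LHS]/(merge_coords (split_coords _)) split_coordsX /split_var -mul_polyC rmorphD rmorphM.
rewrite merge_coordsX merge_coordsC embed_coordsC.
case: unliftP => [j ->|->].
  rewrite merge_coordsC embed_coordsX.
  by rewrite mulrA -mpolyCM subrK.
by rewrite rmorph0 add0r mulrA -mpolyCM divff // mul1r.
Qed.

Lemma merge_coordsK : cancel merge_coords split_coords.
Proof.
have X0 : split_coords 'X_ord_max = (lam ord_max)%:MP *: 'X.
  by rewrite split_coordsX /split_var unlift_none add0r.
apply: (@poly_rmorph_ext _ _ (split_coords \o merge_coords) idfun) => [p|].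
  rewrite -[LHS]/(split_coords (merge_coords _)) merge_coordsC.
  apply: (@mpoly_rmorph_ext _ _ _ (split_coords \o embed_coords) polyC) => [c|i].
    by rewrite -[LHS]/(split_coords (embed_coords _)) embed_coordsC split_coordsC.
  rewrite -[LHS]/(split_coords (embed_coords _)) embed_coordsX rmorphB rmorphM X0 split_coordsC.
  rewrite split_coordsX /split_var liftK -!mul_polyC mulrA -polyCM -mpolyCM.
  by rewrite divfK // addrK.
rewrite -[LHS]/(split_coords (merge_coords _)) merge_coordsX rmorphM X0 split_coordsC.
by rewrite -mul_polyC mulrA -polyCM -mpolyCM mulVf // mul1r.
Qed.

End Coordinates.

(** The coefficient [a] may be zero, so the relation is multiplicative without any condition on
    leading coefficients. *)
Definition top_coef (A : comNzRingType) d (p : {poly A}) a :=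
  (size p <= d.+1)%N /\ p`_d = a.

Lemma top_coefM (A : comNzRingType) d e (p q : {poly A}) a b :
  top_coef d p a -> top_coef e q b -> top_coef (d + e) (p * q) (a * b).
Proof.
move=> [sp pa] [sq qb]; split.
  rewrite (leq_trans (size_polyMleq _ _)) // -subn1 leq_subLR add1n.
  by rewrite (leq_trans (leq_add sp sq)) // addSn addnS.
have di : (d < (d + e).+1)%N by rewrite ltnS leq_addr.
rewrite coefM (bigD1 (Ordinal di)) //= pa addKn qb big1 ?addr0 // => i.
rewrite -val_eqE /= neq_ltn => /orP[] ltid.
  rewrite [q`__]nth_default ?mulr0 // (leq_trans sq) //.
  by rewrite ltn_subRL ltn_add2r.
by rewrite [p`__]nth_default ?mul0r // (leq_trans sp).
Qed.

Lemma top_coef_prod (A : comNzRingType) (I : finType) (d : I -> nat)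
    (p : I -> {poly A}) a :
  (forall i, top_coef (d i) (p i) (a i)) ->
  top_coef (\sum_i d i) (\prod_i p i) (\prod_i a i).
Proof.
move=> H; rewrite /top_coef.
apply: (big_ind3 (fun d p a => top_coef d p a)) => //.
  by rewrite /top_coef size_poly1 coefC.
by move=> *; apply: top_coefM.
Qed.

Lemma top_coefX (A : comNzRingType) (p : {poly A}) a m :
  top_coef 1 p a -> top_coef m (p ^+ m) (a ^+ m).
Proof.
move=> H; elim: m => [|m IH]; first by rewrite !expr0 /top_coef size_poly1 coefC.
by rewrite !exprS -add1n; apply: top_coefM.
Qed.

Lemma top_coef_split_coords (K : fieldType) n (lam : 'I_n.+1 -> K) (f : {mpoly K[n.+1]}) :
  let d := (msize f).-1 in
  top_coef d (split_coords lam f)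
    (\sum_(m <- msupp f | mdeg m == d) f@_m *: 'X_[m]).@[lam]%:MP.
Proof.
move=> d.
have H m : top_coef (mdeg m) (split_coords lam (f@_m *: 'X_[m]))
    ((f@_m *: 'X_[m]).@[lam])%:MP.
  rewrite -mul_mpolyC rmorphM split_coordsC mevalM mevalC mpolyCM -[mdeg m]add0n.
  apply: top_coefM; first by rewrite /top_coef coefC size_polyC; case: (_ != 0).
  rewrite mevalX mpolyXE_id !rmorph_prod mdegE; apply: top_coef_prod => i.
  rewrite !rmorphXn split_coordsX; apply: top_coefX; split.
    rewrite (leq_trans (size_polyD _ _)) // geq_max; apply/andP; split.
      case: unlift => [j|]; last by rewrite size_poly0.
      by rewrite (leq_trans (size_polyC_leq1 _)).
    by rewrite (leq_trans (size_scale_leq _ _)) // size_polyX.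
  rewrite coefD coefZ coefX mulr1; case: unlift => [j|]; last by rewrite coef0 add0r.
  by rewrite coefC add0r.
have le_d m : m \in msupp f -> (mdeg m <= d)%N.
  by move=> /msize_mdeg_lt mf; rewrite -ltnS /d (leq_trans mf) // leqSpred.
have -> : split_coords lam f =
    \sum_(m <- msupp f) split_coords lam (f@_m *: 'X_[m]).
  by rewrite {1}(mpolyE f); apply: rmorph_sum.
split.
  rewrite (leq_trans (size_sum _ _ _)) //; apply/bigmax_leqP_seq => m mf _.
  by have [sm _] := H m; apply: leq_trans sm _; rewrite ltnS le_d.
rewrite coef_sum (rmorph_sum (meval lam)) (rmorph_sum (@mpolyC n K)) [RHS]big_mkcond.
apply: eq_big_seq => m mf.
have [sm cm] := H m; case: eqP => [<-|/eqP nm]; first exact: cm.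
by apply: nth_default; apply: leq_trans sm _; rewrite ltn_neqAle nm le_d.
Qed.

Lemma closed_mpoly_nonroot (K : closedFieldType) n (g : {mpoly K[n]}) :
  g != 0 -> exists v, g.@[v] != 0.
Proof.
elim: n g => [|n IH] g g0.
  exists (fun _ => 0); rewrite (nvar0_mpolyC g) mevalC.
  by apply: contraNneq g0 => E; rewrite (nvar0_mpolyC g) E mpolyC0.
pose lam (i : 'I_n.+1) : K := (i == ord_max)%:R.
have l0 : lam ord_max != 0 by rewrite /lam eqxx oner_eq0.
pose p := split_coords lam g.
have p0 : p != 0.
  by apply: contraNneq g0 => E; rewrite -[g](split_coordsK l0) -/p E rmorph0.
have [|v lv] := IH (lead_coef p); first by rewrite lead_coef_eq0.
have q0 : map_poly (meval v) p != 0.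
  by rewrite -lead_coef_eq0 lead_coef_map_eq.
have [x px] := closed_nonroot q0.
pose e : {rmorphism {mpoly K[n.+1]} -> K} :=
  horner_eval x \o map_poly (meval v) \o split_coords lam.
exists (fun i => e 'X_i); suff -> : g.@[fun i => e 'X_i] = e g by [].
apply: (@mpoly_rmorph_ext _ _ _ (meval _) e) => [c|i]; last exact: mevalXU.
rewrite -[RHS]/((map_poly (meval v) (split_coords lam c%:MP)).[x]) split_coordsC.
by rewrite map_polyC hornerC /= !mevalC.
Qed.

Lemma monic_coordinates (K : closedFieldType) n (f : {mpoly K[n.+1]}) : f != 0 ->
  exists lam (c : K), [/\ lam ord_max != 0, c != 0 & split_coords lam (c%:MP * f) \is monic].
Proof.
move=> f0; pose d := (msize f).-1.
pose g := \sum_(m <- msupp f | mdeg m == d) f@_m *: 'X_[m].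
have g0 : g != 0.
  have lf := mlead_supp f0.
  suff : g@_(mlead f) != 0 by apply: contraNneq => ->; rewrite mcoeff0.
  rewrite /g -big_filter raddf_sum /= (bigD1_seq (mlead f)) /=; last first.
  - by rewrite filter_uniq // msupp_uniq.
  - by rewrite mem_filter lf /d -(mlead_deg f0) eqxx.
  rewrite mcoeffZ mcoeffX eqxx mulr1 big1 ?addr0 ?mleadc_eq0 // => m /negbTE nm.
  by rewrite mcoeffZ mcoeffX nm mulr0.
(* The extra factor makes one point satisfy both requirements: the top part does not vanish there,
   and neither does the last coordinate. *)
have [|lam] := @closed_mpoly_nonroot K _ (g * 'X_ord_max).
  by rewrite mulf_neq0 // -msupp_eq0 msuppX.
rewrite mevalM mulf_eq0 negb_or mevalXU => /andP[gl l0].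
have [sf cf] := top_coef_split_coords lam f.
exists lam, (g.@[lam])^-1; split=> //; first by rewrite invr_eq0.
have sE : size (split_coords lam f) = d.+1.
  apply/eqP; rewrite eqn_leq sf ltnNge; apply: contra gl => s.
  move: cf; rewrite nth_default // => /esym/eqP; rewrite mpolyC_eq0.
  by [].
rewrite rmorphM split_coordsC monicE lead_coefM lead_coefC lead_coefE sE /=.
by rewrite cf -mpolyCM mulVf.
Qed.

(** * The Nullstellensatz and the Quillen-Suslin theorem *)

(** For [J] nonzero, coordinates are chosen with some [g] in [J] monic in the last variable, and
    [phi] is a point of the contraction of [J] to the other variables. If no value of the last
    variable extends [phi] to [J], some [h] in [J] has no root in common with [g] over [phi], and
    elimination yields an element of the contraction outside the kernel of [phi]. *)
Lemma mpoly_nullstellensatz (K : closedFieldType) n : nullstellensatz K {mpoly K[n]}.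
Proof.
elim: n => [|n IH] J J0 JD JM J1.
  exists (meval (fun _ => 0)); split=> [c|x Jx]; first by exists c%:MP; apply: mevalC.
  apply: NNPP => /eqP nx; case: J1.
  have xE := nvar0_mpolyC x; have c0 : x@_0 != 0.
    by apply: contraNneq nx => c0; rewrite xE c0 mpolyC0 rmorph0.
  by have := JM (x@_0)^-1%:MP _ Jx; rewrite {2}xE -mpolyCM mulVf.
case: (classic (exists f, J f /\ f != 0)) => [[f [Jf f0]]|J00]; last first.
  exists (meval (fun _ => 0)); split=> [c|x Jx]; first by exists c%:MP; apply: mevalC.
  have [->|x0] := eqVneq x 0; first by rewrite rmorph0.
  by case: J00; exists x.
have [lam [c [l0 c0 fm]]] := monic_coordinates f0.
set g := split_coords lam _ in fm.
pose I (h : {poly {mpoly K[n]}}) := J (merge_coords lam h).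
have Ig : I g by rewrite /I split_coordsK //; apply: JM.
have ID x y : I x -> I y -> I (x + y) by rewrite /I rmorphD; apply: JD.
have IM a x : I x -> I (a * x) by rewrite /I rmorphM; apply: JM.
have [||||phi [phis phi0]] := IH (fun r => I r%:P).
- by rewrite /I !rmorph0.
- by move=> x y; rewrite polyCD; apply: ID.
- by move=> a x; rewrite polyCM; apply: IM.
- by rewrite /I !rmorph1.
pose ev x : {rmorphism {poly {mpoly K[n]}} -> K} := horner_eval x \o map_poly phi.
case: (classic (exists x, forall h, I h -> ev x h = 0)) => [[x Hx]|nx].
  exists (ev x \o split_coords lam); split.
    move=> a; have [r ra] := phis a; exists (merge_coords lam r%:P).
    rewrite -[LHS]/(ev x (split_coords lam (merge_coords lam r%:P))).
    rewrite merge_coordsK // -[LHS]/((map_poly phi r%:P).[x]).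
    by rewrite map_polyC hornerC.
  by move=> y Jy; apply: Hx; rewrite /I split_coordsK.
suff [h [Ih Hh]] : exists h, I h /\
    forall x, root (map_poly phi g) x -> ~~ root (map_poly phi h) x.
  have [al [be [e [eE /eqP []]]]] := elimination fm Hh.
  by apply: phi0; rewrite eE; apply: ID; apply: IM.
have gn0 : map_poly phi g != 0 by apply/monic_neq0/monic_map.
have [s gs] := closed_field_poly_normal (map_poly phi g).
have mem_s x : root (map_poly phi g) x = (x \in s).
  by rewrite gs rootZ ?lead_coef_eq0 // root_prod_XsubC.
suff [h [Ih Hh]] : exists h, I h /\ forall x, x \in s -> ~~ root (map_poly phi h) x.
  by exists h; split=> // x; rewrite mem_s; apply: Hh.
(* Induction on the roots of [g]: [h] is corrected by a multiple of [hx], an element of [I] not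
   vanishing at the new root, chosen so that no old root becomes a zero. *)
elim: {gs mem_s} s => [|x s [h [Ih Hh]]].
  by exists 0; split=> //; rewrite /I !rmorph0.
have [hx [Ihx hx0]] : exists h, I h /\ ev x h != 0.
  apply: NNPP => nh; case: nx; exists x => h' Ih'; apply/eqP/negPn/negP => e0.
  by case: nh; exists h'.
have [||a Ha] := @avoid_common_roots K (\prod_(z <- x :: s) ('X - z%:P))
  (map_poly phi h) (map_poly phi hx).
- by apply/monic_neq0/monic_prod_XsubC.
- move=> z; rewrite root_prod_XsubC inE => /orP[/eqP-> _ //|zs].
  by rewrite (negbTE (Hh z zs)).
have [r ra] := phis a; exists (h + r%:P * hx); split; first by apply/ID/IM.
move=> z zs; have := Ha z; rewrite root_prod_XsubC => /(_ zs).
by rewrite rmorphD rmorphM /= map_polyC /= ra mul_polyC.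
Qed.

(** The induction hypothesis serves twice: for the cokernel that enters Schanuel's lemma, and for
    the kernels of constant rows that enter cancellation. *)
Theorem quillen_suslin (K : closedFieldType) n : idempotents_free {mpoly K[n]}.
Proof.
elim: n => [|n IH] s P PP.
  apply: (@mx_free_retract _ _ (@mcoeff 0 K 0%MM) (@mpolyC 0 K)).
    exact: mpolyKC.
  by apply: field_idempotents_free; rewrite -map_mxM PP.
have NS := @mpoly_nullstellensatz K n.
have HU : kernels_free {mpoly K[n.+1]}.
  move=> m u w uw; case: (pickP (fun i => u 0 i != 0)) => [i ui|u0]; last first.
    have : u *m w = 0.
      rewrite (_ : u = 0) ?mul0mx //; apply/rowP=> j; apply/eqP.
      by rewrite mxE; apply: negbFE (u0 j).
    rewrite uw => /matrixP /(_ 0 0) /eqP; by rewrite !mxE oner_eq0.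
  have [lam [c [l0 c0 um]]] := monic_coordinates ui.
  apply: (mx_free_retract (split_coordsK l0)).
  (* Rescaling row and column by inverse constants keeps the projector and makes entry [i] monic in
     the new coordinates. *)
  have -> : w *m u = (c^-1%:MP *: w) *m (c%:MP *: u).
    by rewrite -scalemxAl -scalemxAr scalerA -mpolyCM mulVf // scale1r.
  rewrite map_mxB map_mx1 map_mxM; apply: (monic_kernel_free (i := i) NS IH).
    by rewrite !mxE.
  rewrite -map_mxM -scalemxAl -scalemxAr scalerA -mpolyCM divff // scale1r.
  by rewrite uw map_mx1.
have [f [d [X [Y [f0 XY YX]]]]] := generically_free PP.
have [lam [c [l0 c0 fm]]] := monic_coordinates f0.
have [|||q] := @monic_stably_free _ s d (split_coords lam (c%:MP * f))
  (map_mx (split_coords lam) P) (map_mx (split_coords lam) (c%:MP *: X))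
  (map_mx (split_coords lam) Y) IH fm.
- by rewrite -map_mxM PP.
- by rewrite -map_mxM -scalemxAl XY scale_scalar_mx map_scalar_mx.
- by rewrite -map_mxM -scalemxAr YX scalerA map_mxZ.
move=> F; apply: (@mx_free_unstabilize _ _ q) => //.
apply: (mx_free_retract (split_coordsK l0)).
by rewrite map_block_mx !map_mx0 map_mx1.
Qed.

(** * Freeness of the module *)

Lemma msize_mderiv (A : idomainType) n i (f : {mpoly A[n]}) :
  f != 0 -> (msize (mderiv i f) < msize f)%N.
Proof.
move=> f0; rewrite (mpolySpred _ f0) ltnS msizeE; apply/bigmax_leqP_seq => m.
rewrite mcoeff_msupp mcoeff_mderiv => fm _.
have /msize_mdeg_lt : (m + U_(i))%MM \in msupp f.
  by rewrite mcoeff_msupp; apply: contraNneq fm => ->; rewrite mul0rn.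
by rewrite mdegD mdeg1 addn1 (mpolySpred _ f0).
Qed.

Lemma derivation_simple (k : fieldType) n (J : {mpoly k[n]} -> Prop) :
  [pchar k] =i pred0 -> (exists2 f, J f & f != 0) ->
  (forall a f, J f -> J (a * f)) -> (forall i f, J f -> J (mderiv i f)) -> J 1.
Proof.
move=> k0 [f Jf f0] JM Jd.
elim: {f}(msize f) {-2}f (leqnn (msize f)) Jf f0 => [|N IH] f sf Jf f0.
  by move: sf; rewrite leqn0 mmeasure_poly_eq0 (negbTE f0).
case: (leqP (msize f) 1) => [/msize1_polyC fE|f1].
  have c0 : f@_0 != 0 by apply: contraNneq f0 => c0; rewrite fE c0 mpolyC0.
  by have := JM (f@_0)^-1%:MP _ Jf; rewrite {2}fE -mpolyCM mulVf.
set m := mlead f; have : mdeg m != 0%N.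
  by rewrite -lt0n -ltnS mlead_deg.
rewrite mdegE sum_nat_eq0 negb_forall => /existsP[i /= mi].
apply: (IH (mderiv i f)); last 1 first.
(* Differentiation multiplies the leading coefficient by the exponent [m i], which is nonzero in
   characteristic zero. *)
- have : (mderiv i f)@_(m - U_(i)) != 0.
    rewrite mcoeff_mderiv submK ?lep1mP // -mulr_natr mulf_neq0 ?mleadc_eq0 //.
    by rewrite (pcharf0P k).1.
  by apply: contraNneq => ->; rewrite mcoeff0.
- by rewrite -ltnS (leq_trans (msize_mderiv i f0)).
- exact: Jd.
Qed.

Lemma bounded_nat_max (P : nat -> Prop) m : P 0 -> (forall r, P r -> r <= m)%N ->
  exists2 r, P r & forall r', P r' -> (r' <= r)%N.
Proof.
elim: m => [|m IH] P0 Pm; first by exists 0.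
case: (classic (P m.+1)) => [Pm1|nP]; first by exists m.+1.
apply: IH => // r Pr; rewrite -ltnS ltn_neqAle Pm // andbT.
by apply/eqP => rm; apply: nP; rewrite -rm.
Qed.

Lemma vf_act_coord (k : fieldType) n (f g : {mpoly k[n]}) i :
  vf_act (vf_coord f i) g = f * mderiv i g.
Proof.
rewrite /vf_act (bigD1 i) //= mxE eqxx mul1r big1 ?addr0 // => j /negbTE ji.
by rewrite mxE ji !mul0r.
Qed.

Lemma map_mderivM (A : idomainType) n i p q r (U : 'M[{mpoly A[n]}]_(p, q))
    (V : 'M_(q, r)) :
  map_mx (mderiv i) (U *m V) =
  map_mx (mderiv i) U *m V + U *m map_mx (mderiv i) V.
Proof.
apply/matrixP=> a b; rewrite !mxE raddf_sum -big_split; apply: eq_bigr => j _.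
by rewrite !mxE /= mderivM.
Qed.

Section FiniteType.
Variables (k : fieldType) (n : nat) (M : lmodType {mpoly k[n]}).
Local Notation A := {mpoly k[n]}.
Variable act : 'rV[A]_n -> M -> M.
Hypothesis actP : is_AV_action act.

Lemma act0 v : act v 0 = 0.
Proof.
have [actD _ _ _] := actP; have /eqP := actD v 0 0.
by rewrite addr0 -subr_eq0 opprD addrA subrr sub0r oppr_eq0 => /eqP.
Qed.

Lemma act_sum v I (r : seq I) (P : pred I) (F : I -> M) :
  act v (\sum_(i <- r | P i) F i) = \sum_(i <- r | P i) act v (F i).
Proof.
have [actD _ _ _] := actP.
by apply: (big_ind2 (fun x y => act v x = y)) => [|x _ y _ <- <-|//]; rewrite ?act0 ?actD.
Qed.

Variable s : seq M.

Definition lincomb (c : 'rV[A]_(size s)) : M := \sum_j c 0 j *: s`_j.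

Lemma lincombP a u v : lincomb (a *: u + v) = a *: lincomb u + lincomb v.
Proof.
rewrite /lincomb scaler_sumr -big_split; apply: eq_bigr => j _.
by rewrite !mxE scalerDl scalerA.
Qed.

Lemma lincombD u v : lincomb (u + v) = lincomb u + lincomb v.
Proof. by rewrite -[u]scale1r lincombP !scale1r. Qed.

Lemma lincomb0 : lincomb 0 = 0.
Proof. by apply: big1 => j _; rewrite mxE scale0r. Qed.

Lemma lincombZ a u : lincomb (a *: u) = a *: lincomb u.
Proof. by rewrite -[a *: u]addr0 lincombP lincomb0 addr0. Qed.

Lemma lincombB u v : lincomb (u - v) = lincomb u - lincomb v.
Proof. by have := lincombP (-1) v u; rewrite !scaleN1r ![- _ + _]addrC. Qed.

Lemma lincomb_mul p (x : 'rV[A]_p) (N : 'M_(p, size s)) :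
  lincomb (x *m N) = \sum_i x 0 i *: lincomb (row i N).
Proof.
rewrite mulmx_sum_row; apply: (big_ind2 (fun u v => lincomb u = v)).
- exact: lincomb0.
- by move=> u1 v1 u2 v2 <- <-; rewrite lincombD.
- by move=> i _; rewrite lincombZ.
Qed.

Definition relation_splitter a :=
  exists2 Phi : 'M[A]_(size s), forall c, lincomb (c *m Phi) = 0 &
    forall c, lincomb c = 0 -> c *m Phi = a *: c.

(** Finitely many relations [N] of maximal rank span all relations over the fraction field, so a
    pseudo-inverse followed by [N] fixes every relation; [a] clears the denominators of that
    pseudo-inverse. *)
Lemma relation_splitter_neq0 : exists2 a, relation_splitter a & a != 0.
Proof.
pose F p q := @map_mx A {fraction A} (@tofrac A) p q.
pose Q r := exists p (N : 'M[A]_(p, size s)),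
  (forall i, lincomb (row i N) = 0) /\ \rank (F _ _ N) = r.
have [||r [p [N [N0 rN]]] rmax] := @bounded_nat_max Q (size s).
- by exists 0, 0; split=> [[]|] //; apply/eqP; rewrite -leqn0 rank_leq_row.
- by move=> r [p [N [_ <-]]]; apply: rank_leq_col.
have [a [Q' [a0 HQ]]] := common_denominator (pinvmx (F _ _ N)).
exists a => //; exists (Q' *m N) => c.
  by rewrite mulmxA lincomb_mul big1 // => i _; rewrite N0 scaler0.
move=> c0; have FcN : (F _ _ c <= F _ _ N)%MS.
  have le : (F _ _ N <= col_mx (F _ _ N) (F _ _ c))%MS by rewrite -addsmxE addsmxSl.
  have := mxrank_leqif_sup le; rewrite -addsmxE => /leqifP.
  have : (\rank (F _ _ N + F _ _ c) <= \rank (F _ _ N))%N.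
    rewrite rN; apply: rmax; exists (p + 1)%N, (col_mx N c).
    rewrite /F map_col_mx -addsmxE; split=> // i.
    rewrite -[i]splitK; case: (split i) => j /=.
      by rewrite -row_usubmx col_mxKu.
    by rewrite -row_dsubmx col_mxKd ord1 row_id.
  case: ifP => [h _ _|_ h1 h2]; first by rewrite (submx_trans _ h) // -addsmxE addsmxSr.
  by move: h2; rewrite ltnNge h1.
apply: map_tofrac_inj; rewrite map_mxZ !map_mxM -HQ -scalemxAl -scalemxAr mulmxA.
by rewrite mulmxKpV.
Qed.

Hypothesis gen : forall m, exists c, m = lincomb c.

Lemma relation_splitter_mderiv i a :
  relation_splitter a -> relation_splitter (mderiv i a).
Proof.
have [_ _ _ actf] := actP.
have /fin_all_exists [g Hg] j := gen (act (vf_coord 1 i) s`_(j : 'I_(size s))).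
(* The new splitter is the commutator of [Phi] with the connection [D] on [A^s]. *)
pose Gam := \matrix_j g j; pose D (c : 'rV[A]_(size s)) := map_mx (mderiv i) c + c *m Gam.
have HD c : act (vf_coord 1 i) (lincomb c) = lincomb (D c).
  rewrite {1}/lincomb act_sum lincombD lincomb_mul addrC -big_split.
  apply: eq_bigr => j _; rewrite actf rowK -Hg vf_act_coord mul1r; congr (_ + _).
  by rewrite mxE.
move=> [Phi Phi0 PhiK].
have PsiE c : c *m (map_mx (mderiv i) Phi + Phi *m Gam - Gam *m Phi) =
    D (c *m Phi) - D c *m Phi.
  rewrite /D map_mderivM mulmxBr mulmxDr mulmxDl !mulmxA opprD.
  by rewrite [in RHS]addrACA [map_mx _ c *m _ + _]addrC addrK addrA.
exists (map_mx (mderiv i) Phi + Phi *m Gam - Gam *m Phi) => c.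
  by rewrite PsiE lincombB Phi0 subr0 -HD Phi0 act0.
move=> c0; have Dc0 : lincomb (D c) = 0 by rewrite -HD c0 act0.
(* On a relation [c] the commutator is [D (a c) - a D c], and the Leibniz rule leaves
   [mderiv i a *: c]. *)
rewrite PsiE (PhiK _ Dc0) (PhiK _ c0) /D.
have -> : map_mx (mderiv i) (a *: c) = mderiv i a *: c + a *: map_mx (mderiv i) c.
  by apply/matrixP=> p q; rewrite !mxE /= mderivM.
by rewrite scalerDr -scalemxAl opprD addrACA subrr addr0 addrK.
Qed.

Lemma relation_projector : [pchar k] =i pred0 ->
  exists2 Phi : 'M[A]_(size s), forall c, lincomb (c *m Phi) = 0 &
    forall c, lincomb c = 0 -> c *m Phi = c.
Proof.
move=> k0; have [|||Phi Phi0 PhiK] := @derivation_simple k n relation_splitter k0.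
- by have [a] := relation_splitter_neq0; exists a.
- move=> a f [Phi Phi0 PhiK]; exists (a *: Phi) => c.
    by rewrite -scalemxAr lincombZ Phi0 scaler0.
  by move=> /PhiK E; rewrite -scalemxAr E scalerA.
- exact: relation_splitter_mderiv.
by exists Phi => // c /PhiK; rewrite scale1r.
Qed.

End FiniteType.

(** Since [Phi] projects onto the relations, [M] is isomorphic to the image of the complementary
    idempotent [1 - Phi]. *)
Theorem finite_type_free (k : closedFieldType) n (M : lmodType {mpoly k[n]})
    (act : 'rV[{mpoly k[n]}]_n -> M -> M) :
  [pchar k] =i pred0 -> is_AV_action act -> fin_type_Amod M ->
  exists d (phi : 'cV[{mpoly k[n]}]_d -> M), linear phi /\ bijective phi.
Proof.
move=> k0 actP [s sP].
have gen (m : M) : exists c, m = lincomb (s := s) c.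
  have [c ->] := sP m; exists (\row_j c j).
  by apply: eq_bigr => j _; rewrite mxE.
have [Phi Phi0 PhiK] := relation_projector actP gen k0.
have PP : (1%:M - Phi) *m (1%:M - Phi) = 1%:M - Phi.
  rewrite mulmxBr mulmx1 mulmxBl mul1mx.
  suff -> : Phi *m Phi = Phi by rewrite subrr subr0.
  apply/row_matrixP=> i; rewrite row_mul PhiK //.
  by rewrite rowE Phi0.
have [d [Y [X [YX XY]]]] := @quillen_suslin k n _ _ PP.
pose phi (v : 'cV[{mpoly k[n]}]_d) := lincomb (s := s) (v^T *m X).
have phiL : linear phi.
  by move=> a u v; rewrite /phi linearP mulmxDl -scalemxAl lincombP.
have XPhi : X *m Phi = 0.
  have : X *m (1%:M - Phi) = X by rewrite -YX mulmxA XY mul1mx.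
  by rewrite mulmxBr mulmx1 => /eqP; rewrite -subr_eq0 addrC addKr oppr_eq0 => /eqP.
have phi_inj : injective phi.
  have phi0 v : phi v = 0 -> v = 0.
    move=> /PhiK; rewrite -mulmxA XPhi mulmx0 => E.
    by apply: trmx_inj; rewrite trmx0 -[_^T]mulmx1 -XY mulmxA -E mul0mx.
  move=> u v E; apply/eqP; rewrite -subr_eq0; apply/eqP; apply: phi0.
  by have := phiL (-1) v u; rewrite !scaleN1r addrC E subrr addrC => <-; rewrite addrC.
have phi_surj m : exists v, phi v == m.
  have [c ->] := gen m; exists (c *m Y)^T; rewrite /phi trmxK -mulmxA YX.
  by rewrite mulmxBr mulmx1 lincombB Phi0 subr0.
exists d, phi; split=> //.
exists (fun m => xchoose (phi_surj m)) => [v|m]; last exact/eqP/(xchooseP (phi_surj m)).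
by apply: phi_inj; apply/eqP/(xchooseP (phi_surj _)).
Qed.

(** * Polynomials in two sets of variables *)

Lemma mpoly_ring_ind (R : comNzRingType) n (Q : {mpoly R[n]} -> Prop) :
  (forall c, Q c%:MP) -> (forall i, Q 'X_i) ->
  (forall f g, Q f -> Q g -> Q (f + g)) ->
  (forall f g, Q f -> Q g -> Q (f * g)) -> forall f, Q f.
Proof.
move=> QC QX QD QM f; rewrite (mpolyE f).
apply: (big_ind Q) => [|//|m _]; first by rewrite -mpolyC0.
rewrite -mul_mpolyC; apply: (QM) => //; rewrite mpolyXE_id.
apply: (big_ind Q) => [|//|i _]; first by rewrite -mpolyC1.
by elim: (m i) => [|a IH]; rewrite ?expr0 -?mpolyC1 // exprS; apply: QM.
Qed.

Lemma mpoly_additive_ext (R : comNzRingType) n (M : zmodType)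
    (f g : {mpoly R[n]} -> M) :
  {morph f : u v / u + v} -> {morph g : u v / u + v} ->
  (forall a m, f (a *: 'X_[m]) = g (a *: 'X_[m])) -> f =1 g.
Proof.
move=> fD gD fg p; rewrite (mpolyE p).
apply: (big_ind (fun p => f p = g p)) => [|u v fu fv|m _] //.
  have f0 (h : {mpoly R[n]} -> M) : {morph h : u v / u + v} -> h 0 = 0.
    by move=> hD; apply: (addrI (h 0)); rewrite -hD !addr0.
  by rewrite !f0.
by rewrite fD gD fu fv.
Qed.

Lemma mderivXU (R : comNzRingType) n (i j : 'I_n) :
  mderiv i ('X_j : {mpoly R[n]}) = (i == j)%:R.
Proof.
rewrite mderivX mnm1E eq_sym; case: eqVneq => [->|_]; last by rewrite scale0r.
rewrite scale1r (_ : (_ - _)%MM = 0%MM) ?mpolyX0 //.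
by apply/mnmP=> a; rewrite mnmBE subnn mnm0E.
Qed.

Lemma mpolyZX_mul (R : comNzRingType) n (a b : R) (p q : 'X_{1..n}) :
  (a *: 'X_[p]) * (b *: 'X_[q]) = (a * b) *: 'X_[p + q] :> {mpoly R[n]}.
Proof. by rewrite -!mul_mpolyC mpolyXD mpolyCM mulrACA. Qed.

Lemma map_mpolyZX (R : comNzRingType) n (d : {additive R -> R}) a (m : 'X_{1..n}) :
  map_mpoly d (a *: 'X_[m]) = d a *: 'X_[m].
Proof.
apply/mpolyP=> p; rewrite mcoeff_map_mpoly !mcoeffZ !mcoeffX.
by case: (_ == _); rewrite ?mulr1 ?mulr0 ?raddf0.
Qed.

Lemma map_mpoly_derivation (R : comNzRingType) n (d : {additive R -> R}) :
  (forall a b, d (a * b) = d a * b + a * d b) ->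
  forall F G : {mpoly R[n]},
    map_mpoly d (F * G) = map_mpoly d F * G + F * map_mpoly d G.
Proof.
move=> dM F G; move: F; apply: mpoly_additive_ext => [u v|u v|a p].
- by rewrite mulrDl raddfD.
- by rewrite raddfD !mulrDl addrACA.
move: G; apply: mpoly_additive_ext => [u v|u v|b q].
- by rewrite mulrDr raddfD.
- by rewrite raddfD !mulrDr addrACA.
by rewrite mpolyZX_mul !map_mpolyZX dM !mpolyZX_mul scalerDl.
Qed.

(** Both sides are derivations along [phi], so constants and variables decide. *)
Lemma derivation_chain (R S : comNzRingType) n
    (phi : {rmorphism {mpoly R[n]} -> S}) (D : S -> S) :
  {morph D : F G / F + G} -> (forall F G, D (F * G) = D F * G + F * D G) ->
  (forall c, D (phi c%:MP) = 0) ->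
  forall f, D (phi f) = \sum_j D (phi 'X_j) * phi (mderiv j f).
Proof.
move=> DD DM DC; apply: mpoly_ring_ind => [c|i|f g Hf Hg|f g Hf Hg].
- by rewrite DC big1 // => j _; rewrite mderivC rmorph0 mulr0.
- rewrite (bigD1 i) //= big1 => [|j ji]; rewrite mderivXU.
    by rewrite eqxx rmorph1 mulr1 addr0.
  by rewrite (negbTE ji) rmorph0 mulr0.
- rewrite rmorphD DD Hf Hg -big_split; apply: eq_bigr => j _.
  by rewrite mderivD rmorphD mulrDr.
- rewrite rmorphM DM Hf Hg mulr_suml mulr_sumr -big_split; apply: eq_bigr => j _.
  rewrite mderivM rmorphD !rmorphM /= mulrDr !mulrA; congr (_ + _ * _).
  exact: mulrC.
Qed.

Section Shift.
Variables (R S : comNzRingType) (n : nat) (c0 : R -> S) (g : 'I_n -> S).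
Variable phi : {rmorphism {mpoly R[n]} -> {mpoly S[n]}}.
Hypothesis phiC : forall c, phi c%:MP = (c0 c)%:MP.
Hypothesis phiX : forall i, phi 'X_i = 'X_i + (g i)%:MP.

Lemma mderiv_shift i f : mderiv i (phi f) = phi (mderiv i f).
Proof.
rewrite (derivation_chain (D := mderiv i)); first last.
- by move=> c; rewrite phiC mderivC.
- exact: mderivM.
- exact: mderivD.
rewrite (bigD1 i) //= big1 => [|j ji]; rewrite phiX mderivD mderivC mderivXU.
  by rewrite eqxx (mulr1n 1) !addr0 mul1r.
by rewrite eq_sym (negbTE ji) addr0 mul0r.
Qed.

Lemma mderivm_shift m f : mderivm m (phi f) = phi (mderivm m f).
Proof.
rewrite !mderivm_foldr; elim: (flatten _) => //= i s ->.
by rewrite mderiv_shift.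
Qed.

Lemma map_mpoly_shift (d : {additive S -> S}) f :
  (forall a b, d (a * b) = d a * b + a * d b) -> (forall c, d (c0 c) = 0) ->
  map_mpoly d (phi f) = \sum_j (d (g j))%:MP * phi (mderiv j f).
Proof.
move=> dM dC; have d1 : d 1 = 0.
  by apply: (addrI (d 1)); rewrite addr0 -{3}[1]mulr1 dM mulr1 mul1r.
rewrite (derivation_chain (D := map_mpoly d)); first last.
- by move=> c; rewrite phiC map_mpolyC dC mpolyC0.
- exact: map_mpoly_derivation.
- exact: raddfD.
apply: eq_bigr => j _; congr (_ * _).
by rewrite phiX raddfD /= map_mpolyC -['X_j]scale1r map_mpolyZX d1 scale0r add0r.
Qed.

End Shift.

Lemma mpoly_rmorph_exists (R S : comNzRingType) n (f : {rmorphism R -> S})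
    (g : 'I_n -> S) :
  exists phi : {rmorphism {mpoly R[n]} -> S},
    (forall c, phi c%:MP = f c) /\ (forall i, phi 'X_i = g i).
Proof.
exists (mmap f g); split=> [c|i]; first exact: mmapC.
by rewrite /= mmapX mmap1U.
Qed.

(* [{mpoly {mpoly k[n]}[n]}] is k[x, y]: the coefficients are polynomials in [x] and the
   indeterminates are the [y_i].  The morphisms substitute [y], [y - x] and [x + y] for [x],
   [y - x] for [y], and [x] for [y]. *)
Section TwoSets.
Variables (k : fieldType) (n : nat).
Local Notation A := {mpoly k[n]}.
Local Notation A2 := {mpoly A[n]}.
Variables (in_y tau sig : {rmorphism A -> A2}).
Variables (shift : {rmorphism A2 -> A2}) (diag : {rmorphism A2 -> A}).
Hypothesis in_yC : forall c, in_y c%:MP = c%:MP%:MP.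
Hypothesis in_yX : forall i, in_y 'X_i = 'X_i.
Hypothesis tauC : forall c, tau c%:MP = c%:MP%:MP.
Hypothesis tauX : forall i, tau 'X_i = 'X_i - ('X_i)%:MP.
Hypothesis sigC : forall c, sig c%:MP = c%:MP%:MP.
Hypothesis sigX : forall i, sig 'X_i = 'X_i + ('X_i)%:MP.
Hypothesis shiftC : forall a, shift a%:MP = a%:MP.
Hypothesis shiftX : forall i, shift 'X_i = 'X_i - ('X_i)%:MP.
Hypothesis diagC : forall a, diag a%:MP = a.
Hypothesis diagX : forall i, diag 'X_i = 'X_i.

Lemma mderiv_tau i f : mderiv i (tau f) = tau (mderiv i f).
Proof.
apply: (mderiv_shift (c0 := @mpolyC n k) (g := fun i => - 'X_i) tauC) => j.
by rewrite mpolyCN tauX.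
Qed.

(** [tau f] is f(y - x), so its derivatives in x and in y are opposite. *)
Lemma deriv_x_tau i f : map_mpoly (mderiv i) (tau f) = - tau (mderiv i f).
Proof.
rewrite (map_mpoly_shift (c0 := @mpolyC n k) (g := fun i => - 'X_i) tauC).
- rewrite (eq_bigr (fun j => if j == i then - tau (mderiv j f) else 0)).
    by rewrite -big_mkcond big_pred1_eq.
  move=> j _; rewrite -[X in X%:MP]/(mderiv i (- 'X_j)) mderivN mderivXU eq_sym.
  by case: eqP => _; rewrite ?oppr0 ?mpolyC0 ?mul0r // mpolyCN mpolyC1 mulN1r.
- by move=> j; rewrite mpolyCN tauX.
- exact: mderivM.
- exact: mderivC.
Qed.

Lemma diag_tau f : diag (tau f) = f.@[fun _ => 0]%:MP.
Proof.
move: f; apply: mpoly_ring_ind => [c|i|f g Hf Hg|f g Hf Hg].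
- by rewrite tauC diagC mevalC.
- by rewrite tauX rmorphB diagX diagC mevalXU subrr mpolyC0.
- by rewrite !rmorphD Hf Hg.
- by rewrite !rmorphM Hf Hg.
Qed.

Lemma shift_sig f : shift (sig f) = in_y f.
Proof.
move: f; apply: mpoly_ring_ind => [c|i|f g Hf Hg|f g Hf Hg].
- by rewrite sigC shiftC in_yC.
- by rewrite sigX rmorphD shiftX shiftC in_yX subrK.
- by rewrite !rmorphD Hf Hg.
- by rewrite !rmorphM Hf Hg.
Qed.

Lemma in_y_monomial m : in_y 'X_[m] = 'X_[m].
Proof.
rewrite !mpolyXE_id rmorph_prod; apply: eq_bigr => i _.
by rewrite rmorphXn in_yX.
Qed.

Lemma shift_in_y f : shift (in_y f) = tau f.
Proof.
move: f; apply: mpoly_ring_ind => [c|i|f g Hf Hg|f g Hf Hg].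
- by rewrite in_yC shiftC tauC.
- by rewrite in_yX shiftX tauX.
- by rewrite !rmorphD Hf Hg.
- by rewrite !rmorphM Hf Hg.
Qed.

(** The derivatives in y commute with the translation [sig], and setting y = 0 in f(x + y) returns
    [f]. The factorial is kept on the left to avoid dividing. *)
Lemma mcoeff_sig_mfact m f : (sig f)@_m *+ mfact m = mderivm m f.
Proof.
have c0 : forall g, (sig g)@_0 = g.
  apply: mpoly_ring_ind => [c|i|f1 g1 Hf Hg|f1 g1 Hf Hg].
  - by rewrite sigC mcoeffC eqxx mulr1.
  - by rewrite sigX mcoeffD mcoeffC eqxx mulr1 mcoeffX mnm1_eq0 add0r.
  - by rewrite rmorphD mcoeffD Hf Hg.
  - by rewrite rmorphM -[in RHS]Hf -[in RHS]Hg; apply: rmorphM.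
rewrite -[RHS]c0 -(mderivm_shift sigC sigX) mcoeff_mderivm addm0; congr (_ *+ _).
by apply: eq_bigr => i _; rewrite ffactnn.
Qed.

Lemma mderivm_eq0 m (f : A) : (msize f <= mdeg m)%N -> mderivm m f = 0.
Proof.
move=> fm; apply/mpolyP=> p; rewrite mcoeff_mderivm mcoeff0.
rewrite memN_msupp_eq0 ?mul0rn //; apply: msize_mdeg_ge.
by rewrite mdegD (leq_trans fm) // leq_addr.
Qed.

(* The coefficients of [f (x + y)] in [y] are the divided derivatives of [f]; substitute
   [y - x] for [y]. *)
Lemma taylor (k0 : [pchar k] =i pred0) f :
  in_y f = \sum_(m : 'X_{1..n < msize f})
    (((mfact m)%:R^-1 : k)%:MP * mderivm m f) *: tau 'X_[m].
Proof.
have f0 m : (mfact m)%:R != 0 :> k.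
  rewrite (pcharf0P k).1 // -lt0n /mfact.
  by apply: (big_ind (fun a => 0 < a)%N) => // [a b|i _]; rewrite ?muln_gt0 ?fact_gt0 // => -> ->.
have E m : (sig f)@_m = ((mfact m)%:R^-1 : k)%:MP * mderivm m f.
  rewrite -mcoeff_sig_mfact -[_@_m *+ _]mulr_natl mulrA -mpolyC_nat -mpolyCM mulVf //.
  by rewrite mpolyC1 mul1r.
have sf : (msize (sig f) <= msize f)%N.
  rewrite msizeE; apply/bigmax_leqP_seq => m; rewrite mcoeff_msupp E => mf _.
  by rewrite ltnNge; apply: contra mf => /mderivm_eq0 ->; rewrite mulr0.
rewrite -shift_sig {1}(mpolywE sf) rmorph_sum; apply: eq_bigr => m _.
by rewrite -!mul_mpolyC rmorphM shiftC E -shift_in_y in_y_monomial.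
Qed.

End TwoSets.

(** * The action of the subalgebra of vector fields vanishing at the origin *)

Lemma morph_addD (V W : zmodType) (f g : V -> W) :
  {morph f : u v / u + v} -> {morph g : u v / u + v} ->
  {morph (fun x => f x + g x) : u v / u + v}.
Proof. by move=> fD gD u v; rewrite fD gD addrACA. Qed.

Lemma morph_addB (V W : zmodType) (f g : V -> W) :
  {morph f : u v / u + v} -> {morph g : u v / u + v} ->
  {morph (fun x => f x - g x) : u v / u + v}.
Proof. by move=> fD gD u v; rewrite fD gD opprD addrACA. Qed.

Lemma morph_add0 (V W : zmodType) (f : V -> W) : {morph f : u v / u + v} -> f 0 = 0.
Proof. by move=> fD; apply: (addrI (f 0)); rewrite -fD !addr0. Qed.

Lemma morph_addN (V W : zmodType) (f : V -> W) :
  {morph f : u v / u + v} -> {morph f : u / - u}.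
Proof. by move=> fD u; apply: (addrI (f u)); rewrite -fD !subrr morph_add0. Qed.

Lemma morph_add_sum (V W : zmodType) (f : V -> W) (I : Type) (r : seq I) (P : pred I)
    (F : I -> V) : {morph f : u v / u + v} ->
  f (\sum_(i <- r | P i) F i) = \sum_(i <- r | P i) f (F i).
Proof. by move=> fD; apply: (big_morph f fD (morph_add0 fD)). Qed.

Section Theta.
Variables (k : fieldType) (n : nat) (M : lmodType {mpoly k[n]}).
Local Notation A := {mpoly k[n]}.
Local Notation A2 := {mpoly A[n]}.
Variable act : 'rV[A]_n -> M -> M.
Hypothesis actP : is_AV_action act.
Variables (in_y : {rmorphism A -> A2}) (diag : {rmorphism A2 -> A}).
Hypothesis in_yC : forall c, in_y c%:MP = c%:MP%:MP.
Hypothesis in_yX : forall i, in_y 'X_i = 'X_i.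
Hypothesis diagC : forall a, diag a%:MP = a.
Hypothesis diagX : forall i, diag 'X_i = 'X_i.

Lemma vf_actD v : {morph act v : x y / x + y}.
Proof. by case: actP => actD _ _ _ x y; apply: actD. Qed.

Lemma vf_actDl m : {morph act^~ m : u v / u + v}.
Proof.
case: actP => _ actl _ _ u v.
by have := actl 1 u v m; rewrite mpolyC1 !scale1r.
Qed.

Lemma vf_actZ c v m : act (c%:MP *: v) m = c%:MP *: act v m.
Proof.
case: actP => _ actl _ _; have := actl c v 0 m.
by rewrite (morph_add0 (vf_actDl m)) !addr0.
Qed.

Lemma vf_coordD i : {morph (fun f : A => vf_coord f i) : f g / f + g}.
Proof. by move=> f g; apply/rowP=> j; rewrite !mxE mulrDr. Qed.

Lemma vf_coordZ i (a f : A) : vf_coord (a * f) i = a *: vf_coord f i.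
Proof. by apply/rowP=> j; rewrite !mxE mulrCA. Qed.

(* The A-linear extension of [y^p |-> act (x^p d/dx_i)]. *)
Definition theta i (F : A2) (m : M) :=
  \sum_(p <- msupp F) F@_p *: act (vf_mon p i) m.

Lemma thetawE N i F m : (msize F <= N)%N ->
  theta i F m = \sum_(p : 'X_{1..n < N}) F@_p *: act (vf_mon p i) m.
Proof.
move=> lt; pose I : subFinType _ := 'X_{1..n < N}.
rewrite /theta (big_mksub I) //=; first last.
  by move=> x /msize_mdeg_lt /leq_trans; apply.
  by rewrite msupp_uniq.
by rewrite big_rmcond //= => p; move/memN_msupp_eq0 ->; rewrite scale0r.
Qed.

Lemma thetaD i m : {morph theta i ^~ m : F G / F + G}.
Proof.
move=> F G; pose N := maxn (msize (F + G)) (maxn (msize F) (msize G)).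
rewrite !(@thetawE N) ?leq_max ?leqnn ?orbT //.
rewrite -big_split; apply: eq_bigr => p _.
by rewrite mcoeffD scalerDl.
Qed.

Lemma thetaZ i a F m : theta i (a *: F) m = a *: theta i F m.
Proof.
pose N := maxn (msize (a *: F)) (msize F).
rewrite !(@thetawE N) ?leq_maxl ?leq_maxr // scaler_sumr.
by apply: eq_bigr => p _; rewrite mcoeffZ scalerA.
Qed.

Lemma thetaX i p m : theta i 'X_[p] m = act (vf_mon p i) m.
Proof. by rewrite /theta msuppX big_seq1 mcoeffX eqxx scale1r. Qed.

Lemma thetaDr i F : {morph theta i F : x y / x + y}.
Proof.
move=> x y; rewrite /theta -big_split; apply: eq_bigr => p _.
by rewrite vf_actD scalerDr.
Qed.

Lemma theta_in_y i f m : theta i (in_y f) m = act (vf_coord f i) m.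
Proof.
move: f; apply: mpoly_additive_ext => [u v|u v|c p].
- by rewrite rmorphD thetaD.
- by rewrite vf_coordD vf_actDl.
have -> : in_y (c *: 'X_[p]) = c%:MP *: 'X_[p].
  by rewrite -mul_mpolyC rmorphM in_yC (in_y_monomial in_yX) mul_mpolyC.
by rewrite thetaZ -(mul_mpolyC c) vf_coordZ vf_actZ thetaX.
Qed.

Let diagZX a p : diag (a *: 'X_[p]) = a * 'X_[p].
Proof.
rewrite -mul_mpolyC rmorphM diagC mpolyXE_id [in RHS]mpolyXE_id rmorph_prod.
by congr (_ * _); apply: eq_bigr => i _; rewrite rmorphXn diagX.
Qed.

(** The derivative of [g] enters through the restriction of [F] to the diagonal y = x; an [F]
    vanishing there acts A-linearly. *)
Lemma theta_scale i F g m :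
  theta i F (g *: m) = g *: theta i F m + (diag F * mderiv i g) *: m.
Proof.
move: F; apply: mpoly_additive_ext => [u v|u v|a p].
- exact: thetaD.
- by rewrite thetaD rmorphD scalerDr mulrDl scalerDl addrACA.
rewrite !thetaZ !thetaX diagZX; case: actP => _ _ _ ->.
by rewrite vf_act_coord scalerDr !scalerA mulrC mulrA.
Qed.

(** This is the bracket of the tensor product of A and V, with V also acting on the left factor: the
    first difference brackets the vector fields in y, the second differentiates the coefficients in
    x. By additivity it is checked on monomials. *)
Lemma theta_comm i j F G m :
  theta i F (theta j G m) - theta j G (theta i F m) =
  theta j (F * mderiv i G) m - theta i (G * mderiv j F) m +
  (diag F *: theta j (map_mpoly (mderiv i) G) m -
   diag G *: theta i (map_mpoly (mderiv j) F) m).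
Proof.
rewrite -!thetaZ; move: F; apply: mpoly_additive_ext => [||a p].
- apply: morph_addB => u v; first exact: thetaD.
  by rewrite thetaD thetaDr.
- apply: morph_addD; apply: morph_addB => u v.
  + by rewrite mulrDl thetaD.
  + by rewrite mderivD mulrDr thetaD.
  + by rewrite rmorphD scalerDl thetaD.
  + by rewrite raddfD scalerDr thetaD.
move: G; apply: mpoly_additive_ext => [||b q].
- apply: morph_addB => u v; last exact: thetaD.
  by rewrite thetaD thetaDr.
- apply: morph_addD; apply: morph_addB => u v.
  + by rewrite mderivD mulrDr thetaD.
  + by rewrite mulrDl thetaD.
  + by rewrite raddfD scalerDr thetaD.
  + by rewrite rmorphD scalerDl thetaD.
have E c d (r t : 'X_{1..n}) l : c *: 'X_[r] * mderiv l (d *: 'X_[t]) =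
    (c * d) *: in_y ('X_[r] * mderiv l 'X_[t]).
  rewrite mderivZ -!mul_mpolyC mpolyCM rmorphM (in_y_monomial in_yX).
  rewrite !mderivX -!mul_mpolyC rmorphM (in_y_monomial in_yX) in_yC.
  by rewrite !mpolyC_nat mulrACA.
rewrite !E !diagZX !map_mpolyZX !thetaZ !theta_in_y !thetaX.
have [_ _ actB actf] := actP; rewrite !actf !vf_act_coord.
have bracket : act (vf_coord ('X_[p] * mderiv i 'X_[q]) j) m -
    act (vf_coord ('X_[q] * mderiv j 'X_[p]) i) m =
    act (vf_mon p i) (act (vf_mon q j) m) - act (vf_mon q j) (act (vf_mon p i) m).
  rewrite -actB -(morph_addN (vf_actDl m)) -vf_actDl; congr (act _ m).
  apply/rowP=> l; rewrite !mxE !vf_act_coord. 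
  by case: (l == j); case: (l == i) => /=;
    rewrite ?mulr1n ?mulr0n ?mul1r ?mul0r ?mderiv0 ?mulr0.
rewrite [b * a]mulrC -scalerBr bracket.
rewrite scalerBr !scalerDr !scalerA opprD addrACA /=.
by rewrite [b * a]mulrC !mulrA.
Qed.

End Theta.

(** * Eigenvalues of the adjoint action of a matrix *)

Lemma natr_root_bound (A : idomainType) (q : {poly A}) :
  (forall m, (m%:R == 0 :> A) = (m == 0%N)) -> q != 0 ->
  exists N, forall c, (N < c)%N -> ~~ root q (c%:R - 1).
Proof.
move=> A0; have ninj a b : (a%:R - 1 == b%:R - 1 :> A) = (a == b).
  rewrite (inj_eq (addIr _)); wlog ab : a b / (a <= b)%N.
    by case: (leqP a b) => [|/ltnW] ab H; [apply: H | rewrite eq_sym H // eq_sym].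
  by rewrite eq_sym -subr_eq0 -natrB // A0 subn_eq0 eqn_leq ab.
elim: {q}(size q) {-2}q (leqnn (size q)) => [|s IH] q sq q0.
  by move: sq; rewrite leqn0 size_poly_eq0 (negbTE q0).
case: (classic (exists c : nat, root q (c%:R - 1))) => [[c /factor_theorem[q1 qE]]|nr].
  have q10 : q1 != 0 by apply: contraNneq q0 => E; rewrite qE E mul0r.
  have [|N HN] := IH q1 _ q10.
    by move: sq; rewrite qE size_Mmonic ?monicXsubC // size_XsubC addn2 ltnS.
  exists (maxn N c) => e; rewrite gtn_max => /andP[Ne ce].
  by rewrite qE rootM root_XsubC ninj negb_or HN // gtn_eqF.
by exists 0%N => c _; apply/negP => rc; apply: nr; exists c.
Qed.

(** The map [ad E] is a square matrix [G] on the space of matrices. Its characteristic polynomial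
    has no root [c - 1] for large [c], and the adjugate of [c - 1 - G] then forces [Z = 0]. *)
Lemma ad_eigenvalue_bound (A : idomainType) d (E : 'M[A]_d) :
  (forall m, (m%:R == 0 :> A) = (m == 0%N)) ->
  exists N, forall c (Z : 'M_d), (N < c)%N ->
    E *m Z - Z *m E = (c%:R - 1) *: Z -> Z = 0.
Proof.
move=> A0; pose G := lin_mulmx E - lin_mulmxr E.
have [N HN] := natr_root_bound A0 (monic_neq0 (char_poly_monic G)).
exists N => c Z Nc EZ; apply/eqP; apply: contraTT (HN c Nc) => Z0.
rewrite negbK rootE /char_poly -horner_evalE -det_map_mx.
set c1 := _ - 1; have -> : map_mx (horner_eval c1) (char_poly_mx G) = c1%:M - G.
  apply/matrixP=> i j; rewrite !mxE /horner_eval hornerD hornerN hornerC.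
  by rewrite hornerMn hornerX.
have vG : mxvec Z *m (c1%:M - G) = 0.
  rewrite mulmxBr mul_mx_scalar mulmxBr !mul_vec_lin /= -linearB /= EZ.
  by rewrite linearZ subrr.
have := congr1 (fun V => V *m \adj (c1%:M - G)) vG.
rewrite /= -mulmxA mul_mx_adj mul_mx_scalar mul0mx => dZ.
apply: contraNT Z0 => d0; rewrite -mxvec_eq0; apply/eqP.
by apply: (scalemx_inj d0); rewrite dZ scaler0.
Qed.

Section Rho.
Variables (k : fieldType) (n : nat) (M : lmodType {mpoly k[n]}).
Local Notation A := {mpoly k[n]}.
Local Notation A2 := {mpoly A[n]}.
Variable act : 'rV[A]_n -> M -> M.
Hypothesis actP : is_AV_action act.
Variables (in_y tau : {rmorphism A -> A2}) (diag : {rmorphism A2 -> A}).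
Hypothesis in_yC : forall c, in_y c%:MP = c%:MP%:MP.
Hypothesis in_yX : forall i, in_y 'X_i = 'X_i.
Hypothesis tauC : forall c, tau c%:MP = c%:MP%:MP.
Hypothesis tauX : forall i, tau 'X_i = 'X_i - ('X_i)%:MP.
Hypothesis diagC : forall a, diag a%:MP = a.
Hypothesis diagX : forall i, diag 'X_i = 'X_i.
Local Notation theta := (theta act).

(** The coefficients of [eta] are evaluated at y - x. On the diagonal they become [eta] at the
    origin, which is zero for [eta] in L_+. *)
Definition rho_op (eta : 'rV[A]_n) (m : M) : M := \sum_i theta i (tau (eta 0 i)) m.

Let diag_Lplus eta i : in_Lplus eta -> diag (tau (eta 0 i)) = 0.
Proof. by move=> H; rewrite (diag_tau tauC tauX diagC diagX) H mpolyC0. Qed.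

Lemma rho_opD eta : {morph rho_op eta : u v / u + v}.
Proof.
move=> u v; rewrite /rho_op -big_split; apply: eq_bigr => i _.
exact: thetaDr.
Qed.

Lemma rho_op_scale eta g m : in_Lplus eta ->
  rho_op eta (g *: m) = g *: rho_op eta m.
Proof.
move=> H; rewrite /rho_op scaler_sumr; apply: eq_bigr => i _.
by rewrite (theta_scale actP diagC diagX) diag_Lplus // mul0r scale0r addr0.
Qed.

Lemma rho_op_linear c eta xi m :
  rho_op (c%:MP *: eta + xi) m = c%:MP *: rho_op eta m + rho_op xi m.
Proof.
rewrite /rho_op scaler_sumr -big_split; apply: eq_bigr => i _.
by rewrite !mxE rmorphD rmorphM tauC thetaD mul_mpolyC thetaZ.
Qed.

(* Stated separately so that the structure of [0] is inferred once: unifying two inferred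
   structures of a polynomial ring is very slow. *)
Let scale0A (v : M) : (0 : A) *: v = 0 := scale0r v.

Lemma theta0 i m : theta i 0 m = 0.
Proof. exact: morph_add0 (thetaD act i m). Qed.

(** The terms of [theta_comm] that differentiate in x carry the factors f(0) and g(0), hence vanish,
    and [tau] commutes with the remaining derivatives. *)
Lemma theta_tau_comm i j f g m : f.@[fun _ => 0] = 0 -> g.@[fun _ => 0] = 0 ->
  theta i (tau f) (theta j (tau g) m) - theta j (tau g) (theta i (tau f) m) =
  theta j (tau (f * mderiv i g)) m - theta i (tau (g * mderiv j f)) m.
Proof.
move=> f0 g0.
have df : diag (tau f) = 0 by rewrite (diag_tau tauC tauX diagC diagX) f0 mpolyC0.
have dg : diag (tau g) = 0 by rewrite (diag_tau tauC tauX diagC diagX) g0 mpolyC0.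
rewrite (theta_comm actP in_yC in_yX diagC diagX i j (tau f) (tau g) m).
rewrite (mderiv_tau tauC tauX i g) (mderiv_tau tauC tauX j f).
rewrite -[tau f * _]rmorphM -[tau g * _]rmorphM.
set x := theta j (tau _) m - _.
by rewrite df (scale0A _) dg (scale0A _) subr0 addr0.
Qed.

Lemma rho_op_bracket eta xi m : in_Lplus eta -> in_Lplus xi ->
  rho_op (vf_bracket eta xi) m =
  rho_op eta (rho_op xi m) - rho_op xi (rho_op eta m).
Proof.
move=> He Hx.
have dbl (u v : 'rV[A]_n) : rho_op u (rho_op v m) =
    \sum_i \sum_j theta i (tau (u 0 i)) (theta j (tau (v 0 j)) m).
  by apply: eq_bigr => i _; apply/morph_add_sum/thetaDr.
have th (u v : 'rV[A]_n) : \sum_i \sum_j theta j (tau (u 0 i * mderiv i (v 0 j))) m =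
    \sum_j theta j (tau (vf_act u (v 0 j))) m.
  rewrite exchange_big; apply: eq_bigr => j _.
  by rewrite /vf_act rmorph_sum (morph_add_sum _ _ _ (thetaD act j m)).
transitivity (\sum_i \sum_j (theta j (tau (eta 0 i * mderiv i (xi 0 j))) m -
    theta i (tau (xi 0 j * mderiv j (eta 0 i))) m)).
  under [RHS]eq_bigr => i _ do rewrite sumrB.
  rewrite sumrB th exchange_big th -sumrB; apply: eq_bigr => j _.
  by rewrite mxE rmorphB thetaD (morph_addN (thetaD act j m)).
rewrite !dbl [X in _ - X]exchange_big -sumrB; apply: eq_bigr => i _.
rewrite -sumrB; apply: eq_bigr => j _.
by rewrite theta_tau_comm.
Qed.

Lemma theta1 i m : theta i 1 m = act (vf_coord 1 i) m.
Proof. by rewrite -(theta_in_y actP in_yC in_yX) rmorph1. Qed.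

(** The commutator with [d/dx_i] is the sum of the x- and y-derivatives of functions of y - x, which
    cancel. *)
Lemma rho_op_partial i eta m :
  act (vf_coord 1 i) (rho_op eta m) = rho_op eta (act (vf_coord 1 i) m).
Proof.
rewrite /rho_op (morph_add_sum _ _ _ (vf_actD actP _)); apply: eq_bigr => j _.
rewrite -!theta1; apply/eqP; rewrite -subr_eq0.
rewrite (theta_comm actP in_yC in_yX diagC diagX i j 1 (tau (eta 0 j)) m).
have d1 : mderiv j (1 : A2) = 0 by rewrite -(mpolyC1 n A) mderivC.
have dx1 : map_mpoly (mderiv j) (1 : A2) = 0.
  by rewrite -(mpolyC1 n A) map_mpolyC /= -(mpolyC1 n k) mderivC mpolyC0.
rewrite d1 dx1 (theta0 i) scaler0 subr0 rmorph1 scale1r mulr0 theta0 subr0 mul1r.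
by rewrite (mderiv_tau tauC tauX) (deriv_x_tau tauC tauX) -thetaD subrr theta0.
Qed.

Lemma rho_op_mon i p m : rho_op (vf_mon p i) m = theta i (tau 'X_[p]) m.
Proof.
rewrite /rho_op (bigD1 i) //= big1 ?addr0 => [|j ji].
  by rewrite mxE eqxx mul1r.
by rewrite mxE (negbTE ji) mul0r rmorph0 theta0.
Qed.

Lemma act_taylor (sig : {rmorphism A -> A2}) (shift : {rmorphism A2 -> A2}) i f m :
  [pchar k] =i pred0 ->
  (forall c, sig c%:MP = c%:MP%:MP) -> (forall i, sig 'X_i = 'X_i + ('X_i)%:MP) ->
  (forall a, shift a%:MP = a%:MP) -> (forall i, shift 'X_i = 'X_i - ('X_i)%:MP) ->
  act (vf_coord f i) m =
  \sum_(p : 'X_{1..n < msize f})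
    (((mfact p)%:R^-1 : k)%:MP * mderivm p f) *: rho_op (vf_mon p i) m.
Proof.
move=> k0 sigC sigX shiftC shiftX; rewrite -(theta_in_y actP in_yC in_yX).
rewrite (taylor in_yC in_yX tauC tauX sigC sigX shiftC shiftX k0).
rewrite (morph_add_sum _ _ _ (thetaD act i m)); apply: eq_bigr => p _.
by rewrite thetaZ rho_op_mon.
Qed.

End Rho.

(** * Gauge modules *)

Section Operators.
Variables (k : fieldType) (n d : nat) (M : lmodType {mpoly k[n]}).
Local Notation A := {mpoly k[n]}.
Variables (phi : 'cV[A]_d -> M) (psi : M -> 'cV[A]_d).
Hypotheses (phiL : linear phi) (phiK : cancel phi psi) (psiK : cancel psi phi).

Lemma iso_phiD : {morph phi : u v / u + v}.
Proof. by move=> u v; have := phiL 1 u v; rewrite !scale1r. Qed.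

Lemma iso_phiZ a v : phi (a *: v) = a *: phi v.
Proof. by have := phiL a v 0; rewrite (morph_add0 iso_phiD) !addr0. Qed.

Definition op_mx (O : M -> M) : 'M[A]_d :=
  \matrix_(a, b) psi (O (phi (delta_mx b 0))) a 0.

Lemma op_mx_sum O v : phi (op_mx O *m v) = \sum_b v b 0 *: O (phi (delta_mx b 0)).
Proof.
have -> : op_mx O *m v = \sum_b v b 0 *: psi (O (phi (delta_mx b 0))).
  apply/colP=> a; rewrite mxE summxE; apply: eq_bigr => b _.
  by rewrite !mxE mulrC.
rewrite (morph_add_sum _ _ _ iso_phiD); apply: eq_bigr => b _.
by rewrite iso_phiZ psiK.
Qed.

Lemma iso_phi_sum v : phi v = \sum_b v b 0 *: phi (delta_mx b 0).
Proof.
rewrite {1}[v]matrix_sum_delta (morph_add_sum _ _ _ iso_phiD).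
by apply: eq_bigr => b _; rewrite big_ord1 iso_phiZ.
Qed.

Lemma op_mxE O : {morph O : u v / u + v} -> (forall a m, O (a *: m) = a *: O m) ->
  forall v, phi (op_mx O *m v) = O (phi v).
Proof.
move=> OD OZ v; rewrite op_mx_sum [in RHS]iso_phi_sum (morph_add_sum _ _ _ OD).
by apply: eq_bigr => b _; rewrite OZ.
Qed.

Lemma op_mx_inj (U V : 'M[A]_d) : (forall v, phi (U *m v) = phi (V *m v)) -> U = V.
Proof.
move=> UV; apply/matrixP=> a b; have /(can_inj phiK) := UV (delta_mx b 0).
by rewrite -!colE => /colP /(_ a); rewrite !mxE.
Qed.

(** The action of [d/dx_i] is not A-linear: its matrix records the values on the basis, and the
    Leibniz rule adds the derivatives of the coordinates. *)
Lemma op_mx_covD (act : 'rV[A]_n -> M -> M) (actP : is_AV_action act) i v :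
  phi (covD (fun i => op_mx (act (vf_coord 1 i))) i v) = act (vf_coord 1 i) (phi v).
Proof.
rewrite /covD iso_phiD op_mx_sum [in RHS]iso_phi_sum iso_phi_sum.
rewrite (morph_add_sum _ _ _ (vf_actD actP _)) -big_split; apply: eq_bigr => b _.
have [_ _ _ ->] := actP; rewrite vf_act_coord mul1r addrC; congr (_ + _).
by rewrite mxE.
Qed.

End Operators.

Lemma vf_mon_Lplus (k : fieldType) n (m : 'X_{1..n}) i :
  m != 0%MM -> in_Lplus (vf_mon m i : 'rV[{mpoly k[n]}]_n).
Proof.
move=> m0 j; rewrite mxE mevalM mevalX.
have [l ml] : exists l, m l != 0%N.
  apply/existsP; rewrite -negb_forall; apply: contra m0 => /forallP H.
  by apply/eqP/mnmP => l; rewrite mnm0E; apply/eqP/H.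
by rewrite (bigD1 l) //= expr0n (negbTE ml) mul0r mulr0.
Qed.

Definition euler_field (k : fieldType) n : 'rV[{mpoly k[n]}]_n := \row_j 'X_j.

(** The Euler field measures degree: [x^m] contributes [|m|] and [d/dx_i] contributes -1. *)
Lemma euler_bracket (k : fieldType) n (m : 'X_{1..n}) i :
  vf_bracket (euler_field k n) (vf_mon m i) =
  (((mdeg m)%:R - 1) : k)%:MP *: vf_mon m i.
Proof.
have euler_mon : vf_act (euler_field k n) 'X_[m] = (mdeg m)%:R * 'X_[m].
  rewrite /vf_act mdegE natr_sum mulr_suml; apply: eq_bigr => j _.
  rewrite mxE mderivX -mul_mpolyC mpolyC_nat mulrCA -mpolyXD.
  have [->|mj] := eqVneq (m j) 0%N; first by rewrite !mul0r.
  by rewrite addmC submK // lep1mP.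
apply/rowP=> j; rewrite !mxE [X in _ - X]vf_act_coord mderivXU.
rewrite mpolyCB mpolyC_nat mpolyC1 mulrBl mul1r.
case: (eqVneq j i) => _.
  by rewrite (mulr1n 1) !mul1r mulr1 euler_mon.
rewrite (mulr0n 1) !mul0r !mulr0 !subr0.
by apply: big1 => l _; rewrite mderiv0 mulr0.
Qed.

Lemma vf_coord1_comm (k : fieldType) n (i j : 'I_n) :
  vf_bracket (vf_coord 1 i) (vf_coord 1 j) = 0 :> 'rV[{mpoly k[n]}]_n.
Proof.
have d1 l (b : bool) : mderiv l (b%:R * 1 : {mpoly k[n]}) = 0.
  by rewrite mulr1 -mpolyC_nat mderivC.
by apply/rowP=> l; rewrite !mxE !vf_act_coord !d1 !mulr0 subrr.
Qed.

Lemma free_gauge_module (k : fieldType) (hchar : [pchar k] =i pred0) (n : nat)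
  (M : lmodType {mpoly k[n]}) (act : 'rV[{mpoly k[n]}]_n -> M -> M)
  d (phi : 'cV[{mpoly k[n]}]_d -> M) (psi : M -> 'cV[{mpoly k[n]}]_d) :
  is_AV_action act -> linear phi -> cancel phi psi -> cancel psi phi ->
  exists (rho : 'rV[{mpoly k[n]}]_n -> 'M[{mpoly k[n]}]_d)
         (B : 'I_n -> 'M[{mpoly k[n]}]_d),
    [/\ is_Lplus_rep rho, is_gauge_fields rho B
      & forall (i : 'I_n) (f g : {mpoly k[n]}) (u : 'cV[k]_d),
          act (vf_coord f i) (phi (g *: constv u)) = phi (gauge_rhs rho B i f g u)].
Proof.
move=> actP phiL phiK psiK.
pose A := {mpoly k[n]}; pose A2 := {mpoly A[n]}.
pose CC : {rmorphism k -> A2} := @mpolyC n A \o @mpolyC n k.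
have [in_y [in_yC in_yX]] := mpoly_rmorph_exists CC (fun i => 'X_i).
have [tau [tauC tauX]] := mpoly_rmorph_exists CC (fun i => 'X_i - ('X_i)%:MP).
have [sig [sigC sigX]] := mpoly_rmorph_exists CC (fun i => 'X_i + ('X_i)%:MP).
have [shift [shiftC shiftX]] :=
  mpoly_rmorph_exists (@mpolyC n A) (fun i => 'X_i - ('X_i)%:MP).
have [diag [diagC diagX]] :=
  mpoly_rmorph_exists (idfun : {rmorphism A -> A}) (fun i => 'X_i).
pose R := rho_op act tau.
have RD eta : {morph R eta : u v / u + v} by apply: rho_opD.
have RZ eta a m : in_Lplus eta -> R eta (a *: m) = a *: R eta m.
  by apply: (rho_op_scale actP tauC tauX diagC diagX).
have [rho rhoE] : exists rho : 'rV[A]_n -> 'M[A]_d,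
    forall eta v, in_Lplus eta -> phi (rho eta *m v) = R eta (phi v).
  exists (fun eta => op_mx phi psi (R eta)) => eta v H.
  by apply: (op_mxE phiL psiK (RD eta)) => a m; apply: RZ.
have [B BE] : exists B : 'I_n -> 'M[A]_d,
    forall i v, phi (covD B i v) = act (vf_coord 1 i) (phi v).
  exists (fun i => op_mx phi psi (act (vf_coord 1 i))) => i v.
  exact: (op_mx_covD phiL psiK actP).
have mx_inj := op_mx_inj phiK.
have phiD := iso_phiD phiL; have phiZ := iso_phiZ phiL.
have LD (c : k) (eta xi : 'rV[A]_n) :
    in_Lplus eta -> in_Lplus xi -> in_Lplus (c%:MP *: eta + xi).
  by move=> He Hx i; rewrite !mxE mevalD mevalM He Hx mulr0 addr0.
have Lbr (eta xi : 'rV[A]_n) : in_Lplus eta -> in_Lplus xi -> in_Lplus (vf_bracket eta xi).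
  have va (v : 'rV[A]_n) g : in_Lplus v -> (vf_act v g).@[fun _ => 0] = 0.
    by move=> Hv; rewrite raddf_sum /= big1 // => j _; rewrite mevalM Hv mul0r.
  by move=> He Hx i; rewrite mxE mevalB !va // subrr.
have rho_br eta xi : in_Lplus eta -> in_Lplus xi ->
    rho (vf_bracket eta xi) = rho eta *m rho xi - rho xi *m rho eta.
  move=> He Hx; apply: mx_inj => v.
  have rr u w : in_Lplus u -> in_Lplus w -> phi (rho u *m rho w *m v) = R u (R w (phi v)).
    by move=> Hu Hw; rewrite -mulmxA (rhoE _ _ Hu) (rhoE _ _ Hw).
  apply: etrans (rhoE _ _ (Lbr _ _ He Hx)) _.
  apply: etrans (rho_op_bracket actP in_yC in_yX tauC tauX diagC diagX _ He Hx) _.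
  rewrite mulmxBl phiD (morph_addN phiD).
  exact: (congr2 (fun x y => x - y) (esym (rr _ _ He Hx)) (esym (rr _ _ Hx He))).
have rho_lin (c : k) eta xi : in_Lplus eta -> in_Lplus xi ->
    rho (c%:MP *: eta + xi) = c%:MP *: rho eta + rho xi.
  move=> He Hx; apply: mx_inj => v.
  apply: etrans (rhoE _ _ (LD c _ _ He Hx)) _.
  rewrite mulmxDl -scalemxAl phiD phiZ (rhoE _ _ He) (rhoE _ _ Hx).
  exact: (rho_op_linear act tauC).
exists rho, B; split.
- split=> //.
  have A0 m : (m%:R == 0 :> A) = (m == 0%N).
    by rewrite -mpolyC_nat mpolyC_eq0 (pcharf0P k).1.
  have [N HN] := ad_eigenvalue_bound (rho (euler_field k n)) A0.
  exists N => m i Nm; apply: (HN _ _ Nm).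
  have m0 : m != 0%MM by rewrite -mdeg_eq0 -lt0n (leq_ltn_trans _ Nm).
  have Lm := vf_mon_Lplus k i m0.
  have Le : in_Lplus (euler_field k n) by move=> j; rewrite mxE mevalXU.
  (* Adding zero gives the scalar multiple the form [c *: eta + xi] in which linearity of [rho] is
     stated. *)
  rewrite -rho_br // euler_bracket -[_ *: vf_mon m i]addr0.
  have L0 : in_Lplus (0 : 'rV[A]_n) by move=> j; rewrite mxE meval0.
  have rho0 : rho 0 = 0.
    have := rho_lin (-1) 0 0 L0 L0.
    by rewrite scaler0 addr0 mpolyCN mpolyC1 scaleN1r addNr.
  by rewrite rho_lin // rho0 addr0 mpolyCB mpolyC_nat mpolyC1.
- split=> [i j v|i eta v He]; apply: (can_inj phiK).
    apply: etrans (BE _ _) _; apply: etrans (congr1 _ (BE _ _)) _; apply: esym.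
    apply: etrans (BE _ _) _; apply: etrans (congr1 _ (BE _ _)) _; apply: esym.
    apply/eqP; have [_ _ actB _] := actP.
    by rewrite -subr_eq0 -actB vf_coord1_comm (morph_add0 (vf_actDl actP _)).
  apply: etrans (BE _ _) _; rewrite (rhoE _ v He); apply: esym.
  apply: etrans (rhoE _ _ He) _; rewrite BE; apply: esym.
  exact: (rho_op_partial actP in_yC in_yX tauC tauX diagC diagX).
move=> i f g u; have [_ _ _ actf] := actP.
rewrite phiZ actf vf_act_coord /gauge_rhs !phiD !phiZ.
have BC : phi (B i *m constv u) = act (vf_coord 1 i) (phi (constv u)).
  rewrite -BE /covD (_ : map_mx (mderiv i) (constv u) = 0) ?add0r //.
  by apply/matrixP=> a b; rewrite !mxE mderivC.
rewrite (act_taylor actP in_yC in_yX tauC tauX i f _ hchar sigC sigX shiftC shiftX).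
rewrite (morph_add_sum _ _ _ phiD) BC [LHS]addrC -addrA; congr (_ + _).
set m0 := phi _; rewrite -/R.
have RE (p : 'X_{1..n}) : p != 0%MM -> phi (rho (vf_mon p i) *m constv u) = R (vf_mon p i) m0.
  by move=> p0; rewrite rhoE //; apply: vf_mon_Lplus.
under [in RHS]eq_bigr => p p0 do rewrite phiZ RE //.
(* For [f = 0] the index set is empty, since [msize 0 = 0]. Otherwise it contains the index 0, whose
   Taylor term supplies the part with [B i]. *)
rewrite scaler_sumr; have [f0|f0] := eqVneq f 0.
  have z p : mderivm p f = 0 by rewrite f0; apply: raddf0.
  rewrite !big1 ?addr0 => [|p _|p _]; rewrite ?z ?mulr0 ?scale0r ?scaler0 //.
  by rewrite f0 mul0r scale0r.
have lt0 : (mdeg (0%MM : 'X_{1..n}) < msize f)%N.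
  by rewrite mdeg0 lt0n mmeasure_poly_eq0.
rewrite (bigD1 (BMultinom lt0)) //=; congr (_ + _).
  have -> : mfact (0%MM : 'X_{1..n}) = 1%N by apply: big1 => j _; rewrite mnm0E.
  rewrite invr1 mpolyC1 mul1r mderivm0m scalerA mulrC; congr (_ *: _).
  by rewrite /R rho_op_mon mpolyX0 rmorph1 (theta1 actP in_yC in_yX).
apply: eq_big => [p|p _]; first by rewrite bmeqP.
by rewrite scalerA; congr (_ *: _); rewrite mulrA [g * _]mulrC.
Qed.

Theorem theorem5p4 (k : closedFieldType) (hchar : [pchar k] =i pred0) (n : nat)
  (M : lmodType {mpoly k[n]}) (act : 'rV[{mpoly k[n]}]_n -> M -> M) :
  is_AV_action act -> fin_type_Amod M ->
  exists (d : nat) (phi : 'cV[{mpoly k[n]}]_d -> M)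
         (rho : 'rV[{mpoly k[n]}]_n -> 'M[{mpoly k[n]}]_d)
         (B : 'I_n -> 'M[{mpoly k[n]}]_d),
    [/\ linear phi, bijective phi,
        is_Lplus_rep rho, is_gauge_fields rho B
      & forall (i : 'I_n) (f g : {mpoly k[n]}) (u : 'cV[k]_d),
          act (vf_coord f i) (phi (g *: constv u)) = phi (gauge_rhs rho B i f g u)].
Proof.
move=> actP finM; have [d [phi [phiL phiB]]] := finite_type_free hchar actP finM.
have [psi phiK psiK] := phiB.
have [rho [B [rhoP BP E]]] := free_gauge_module hchar actP phiL phiK psiK.
by exists d, phi, rho, B.
Qed.
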